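(* Let $\psi$ be a polynomial with real coefficients, of degree greater than one and without fixed points (i.e. $\psi(x)\ne x$ for all $x\in\mathbb{R}$), and let $d>2$. Let $D(A)=\{f\in\Sigma_d(\mathbb{R}): f\circ\psi\in\Sigma_d(\mathbb{R})\}$ and let $A:D(A)\subset\Sigma_d(\mathbb{R})\to\Sigma_d(\mathbb{R})$ be the linear operator $Af=f\circ\psi$. Then the Waelbroeck spectrum $\sigma^*(A)$ is not compact.
   Context: $\mathbb{N}_0=\{0,1,2,\dots\}$. For $d>1$ put $\omega(t)=t^{1/d}$, $\varphi_\omega(t)=\omega(e^t)$ and $\varphi_\omega^*(s)=\sup\{st-\varphi_\omega(t):t\ge0\}$, $s\ge0$. The Gelfand-Shilov space $\Sigma_d(\mathbb{R})$ is the space of all $f\in C^\infty(\mathbb{R})$ (complex valued) with $$\|f\|_{\omega,\lambda}:=\sup_{x\in\mathbb{R}}\sup_{n,q\in\mathbb{N}_0}(1+|x|)^q|f^{(n)}(x)|\exp\left(-\lambda\varphi_\omega^*\left(\tfrac{n+q}{\lambda}\right)\right)<\infty\quad\text{for every }\lambda>0,$$ a Fréchet space with the topology given by these seminorms. For a Fréchet space $E$ and a linear operator $T:D(T)\subset E\to E$ defined on a linear subspace $D(T)$, the resolvent set is $\rho(T)=\{\lambda\in\mathbb{C}:\ \lambda I-T:D(T)\to E \text{ is bijective and }(\lambda I-T)^{-1}\in\mathcal{L}(E)\}$, where $\mathcal{L}(E)$ is the space of continuous linear operators on $E$. The set $\rho^*(T)$ consists of those $\lambda\in\rho(T)$ for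 which there is an open neighbourhood $V(\lambda)\subset\rho(T)$ of $\lambda$ such that $\{(\mu I-T)^{-1}:\mu\in V(\lambda)\}$ is equicontinuous in $\mathcal{L}(E)$. The Waelbroeck spectrum is $\sigma^*(T)=\mathbb{C}\setminus\rho^*(T)$. *)

(* Defs.v *)
From HB Require Import structures.
From mathcomp Require Import all_boot all_order all_algebra.
From mathcomp Require Import all_classical all_reals all_analysis.
From mathcomp Require Import complex ring lra.
Set Implicit Arguments.
Unset Strict Implicit.
Unset Printing Implicit Defensive.
Import Order.TTheory GRing.Theory Num.Theory.
Import numFieldNormedType.Exports.
Local Open Scope classical_set_scope.
Local Open Scope ring_scope.
Local Open Scope complex_scope.

Local Notation normc := complex.ComplexField.Normc.normc.
Local Notation Re := (@complex.Re _).
Local Notation Im := (@complex.Im _).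

(* The library states equicontinuity for a pointed codomain; a topological
   vector space is not declared pointed, so it is pointed here at 0. *)
Definition pointed_tvs (K : numFieldType) (E : tvsType K) : Type := E.
HB.instance Definition _ (K : numFieldType) (E : tvsType K) :=
  Uniform.on (pointed_tvs E).
HB.instance Definition _ (K : numFieldType) (E : tvsType K) :=
  isPointed.Build (pointed_tvs E) (0 : E).

Section WaelbroeckSpectrum.
Context (K : numFieldType) (E : tvsType K) (D : set E) (T : D -> E).

Definition scalar_sub_op (l : K) (x : D) : E := l *: val x - T x.

Definition continuous_linear (S : E -> E) : Prop := linear S /\ continuous S.

(* S, read as a map into E, is the two-sided inverse of l I - T : D -> E; it
   exists exactly when l I - T is bijective, and is then unique. *)
Definition is_resolvent (l : K) (S : E -> E) : Prop :=
  exists g : E -> D,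
    [/\ cancel (scalar_sub_op l) g, cancel g (scalar_sub_op l)
      & forall y, S y = val (g y)].

Definition resolvent_set : set K^o :=
  [set l | exists2 S : E -> E, is_resolvent l S & continuous_linear S].

Definition Waelbroeck_resolvent_set : set K^o :=
  [set l | resolvent_set l /\
    exists V : set K^o, [/\ open V, V l, V `<=` resolvent_set &
      @equicontinuous E (pointed_tvs E) (E -> E)
        [set S | exists2 m, V m & is_resolvent m S] id]].

Definition Waelbroeck_spectrum : set K^o := ~` Waelbroeck_resolvent_set.

End WaelbroeckSpectrum.

Section NormC.
Context {R : realType}.
Implicit Types z w : R[i].

Lemma normc_normr z : (normc z)%:C = `|z|.
Proof. by case: z. Qed.

Lemma normc_ge0 z : 0 <= normc z.
Proof. by case: z => a b; exact: sqrtr_ge0. Qed.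

Lemma normc_opp z : normc (- z) = normc z.
Proof. by case: z => a b; rewrite /= !sqrrN. Qed.

Lemma normc_lt z (e : R) : (`|z| < e%:C) = (normc z < e).
Proof. by rewrite -normc_normr ltcR. Qed.

Lemma normc_leD z w : normc (z + w) <= normc z + normc w.
Proof. by rewrite -lecR rmorphD /= !normc_normr ler_normD. Qed.

Lemma normc_mul z w : normc (z * w) = normc z * normc w.
Proof. exact: ComplexField.Normc.normcM. Qed.

End NormC.

Lemma mul_div_gt0 (R : realType) (x y : R) : 0 < y -> x = x / y * y.
Proof. by move=> y0; rewrite divfK// gt_eqF. Qed.

(* The topology on a complex vector space generated by a family of seminorms. *)
Section SeminormTopology.
Context {R : realType} {E : lmodType R[i]} {I : Type} (p : I -> E -> R).

Definition seminorm_ball (s : seq I) (e : R) (x : E) : set E :=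
  [set y | all (fun i => p i (x - y) < e) s].

Definition seminorm_entourage : set_system (E * E) :=
  [set A | exists (s : seq I) (e : R), 0 < e /\
    forall x y, seminorm_ball s e x y -> A (x, y)].

Hypothesis p_ge0 : forall i x, 0 <= p i x.
Hypothesis pD : forall i x y, p i (x + y) <= p i x + p i y.
Hypothesis pZ : forall i c x, p i (c *: x) <= normc c * p i x.

Lemma seminorm0 i : p i 0 = 0.
Proof.
apply/eqP; rewrite eq_le p_ge0 andbT.
by have := pZ i 0 0; rewrite scale0r ComplexField.Normc.normc0 mul0r.
Qed.

Lemma seminormN i x : p i (- x) = p i x.
Proof.
have N1 : normc (-1 : R[i]) = 1 by rewrite /= oppr0 expr0n addr0 sqrrN expr1n sqrtr1.
have H y : p i (- y) <= p i y by have := pZ i (-1) y; rewrite scaleN1r N1 mul1r.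
by apply/eqP; rewrite eq_le H /= -{1}(opprK x) H.
Qed.

Lemma seminorm_ball_center s e x : 0 < e -> seminorm_ball s e x x.
Proof.
by move=> e0; apply: (sub_all _ (all_predT s)) => i _; rewrite subrr seminorm0.
Qed.

Lemma seminorm_ball_sym s e x y : seminorm_ball s e x y -> seminorm_ball s e y x.
Proof. by apply: sub_all => i; rewrite -[y - x]opprB seminormN. Qed.

Lemma seminorm_ball_le s e e' x y :
  e <= e' -> seminorm_ball s e x y -> seminorm_ball s e' x y.
Proof. by move=> ee'; apply: sub_all => i /lt_le_trans; apply. Qed.

Lemma seminorm_ball_trans s e e' x y z : seminorm_ball s e x y ->
  seminorm_ball s e' y z -> seminorm_ball s (e + e') x z.
Proof.
rewrite /seminorm_ball /=; elim: s => //= i s IH /andP[xy sxy] /andP[yz syz].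
rewrite IH // andbT.
by rewrite -(subrK y x) -addrA (le_lt_trans (pD _ _ _))// ltrD.
Qed.

Lemma seminorm_entourage_filter : Filter seminorm_entourage.
Proof.
split; first by exists [::], 1; split.
- move=> A B [s [e [e0 sA]]] [t [e' [e'0 tB]]].
  exists (s ++ t), (Num.min e e'); split; first by rewrite lt_min e0.
  move=> x y; rewrite /seminorm_ball /= all_cat => /andP[sxy txy]; split.
  + by apply: sA; apply: seminorm_ball_le sxy; rewrite ge_min lexx.
  + by apply: tB; apply: seminorm_ball_le txy; rewrite ge_min lexx orbT.
- by move=> A B AB [s [e [e0 sA]]]; exists s, e; split => // x y /sA /AB.
Qed.

Lemma seminorm_entourage_diagonal A : seminorm_entourage A -> diagonal `<=` A.
Proof.
move=> [s [e [e0 sA]]] [x y] xy; have {xy}<- : x = y by exact: xy.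
exact/sA/seminorm_ball_center.
Qed.

Lemma seminorm_entourage_inv A :
  seminorm_entourage A -> seminorm_entourage A^-1%relation.
Proof.
by move=> [s [e [e0 sA]]]; exists s, e; split => // x y /seminorm_ball_sym/sA.
Qed.

Lemma seminorm_entourage_split A : seminorm_entourage A ->
  exists2 B, seminorm_entourage B & (B \; B)%relation `<=` A.
Proof.
move=> [s [e [e0 sA]]].
exists [set xy | seminorm_ball s (e / 2) xy.1 xy.2].
  by exists s, (e / 2); split; [rewrite divr_gt0|].
move=> [x z] [y /= xy yz]; apply: sA.
by rewrite (splitr e); exact: seminorm_ball_trans yz.
Qed.

Lemma seminorm_bound s x : exists2 M, 0 < M & all (fun i => p i x < M) s.
Proof.
elim: s => [|i s [M M0 sM]]; first by exists 1.
exists (M + p i x) => /=; first by rewrite ltr_pwDl.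
rewrite ltrDr M0 /=; apply: sub_all sM => j /lt_le_trans; apply.
by rewrite lerDl.
Qed.

Lemma seminorm_ballD s e e' x x' y y' : seminorm_ball s e x x' ->
  seminorm_ball s e' y y' -> seminorm_ball s (e + e') (x + y) (x' + y').
Proof.
rewrite /seminorm_ball /=; elim: s => //= i s IH /andP[xy sxy] /andP[yz syz].
by rewrite IH // andbT opprD addrACA (le_lt_trans (pD _ _ _))// ltrD.
Qed.

Lemma seminorm_ballZ s e (c : R[i]) x y M : normc c < M ->
  seminorm_ball s e x y -> seminorm_ball s (M * e) (c *: x) (c *: y).
Proof.
move=> cM; apply: sub_all => i xy; rewrite -scalerBr (le_lt_trans (pZ _ _ _))//.
have M0 : 0 < M by apply: le_lt_trans cM; exact: normc_ge0.
by rewrite (@le_lt_trans _ _ (M * p i (x - y)))// ?ltr_pM2l// ler_wpM2r// ltW.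
Qed.

Lemma seminorm_ballZl s (c c' : R[i]) x M e : all (fun i => p i x < M) s ->
  0 < e -> normc (c - c') < e -> seminorm_ball s (e * M) (c *: x) (c' *: x).
Proof.
move=> sM e0 cc'; apply: sub_all sM => i xM; rewrite -scalerBl.
rewrite (le_lt_trans (pZ _ _ _))// (@le_lt_trans _ _ (e * p i x))//.
  by rewrite ler_wpM2r// ltW.
by rewrite ltr_pM2l.
Qed.

Lemma seminorm_ball_convex s e x :
  convex_set (seminorm_ball s e x : set (convex_lmodType E)).
Proof.
apply/convex_setW => y z; rewrite !inE => xy xz l l0 l1; rewrite inE.
have nl : (normc l%:num)%:C = l%:num by rewrite normc_normr gtr0_norm.
have nl' : (normc (1 - l%:num))%:C = 1 - l%:num
  by rewrite normc_normr gtr0_norm// subr_gt0.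
have n1 : normc l%:num + normc (1 - l%:num) = 1.
  apply: complexI; rewrite rmorphD /= nl nl'; exact: subrKC.
have n0 : 0 < normc l%:num by rewrite -ltcR nl.
have n0' : 0 < normc (1 - l%:num) by rewrite -ltcR nl' subr_gt0.
move: xy xz; rewrite /seminorm_ball /=; elim: s => //= i s IH.
move=> /andP[xy sxy] /andP[xz sxz]; rewrite IH // andbT.
have -> : x - conv l (y : convex_lmodType E) z =
    l%:num *: (x - y) + (1 - l%:num) *: (x - z).
  rewrite /conv/= !scalerBr addrACA -scalerDl subrKC scale1r.
  by rewrite opprD.
rewrite (le_lt_trans (pD _ _ _))//.
rewrite (le_lt_trans (lerD (pZ _ _ _) (pZ _ _ _)))//.
by rewrite -[ltRHS]mul1r -n1 mulrDl ltrD// ltr_pM2l.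
Qed.

End SeminormTopology.

HB.factory Record Lmodule_isSeminormTvs (R : realType) E
    & GRing.Lmodule R[i] E := {
  seminorm_index : Type ;
  seminorm : seminorm_index -> E -> R ;
  seminorm_ge0 : forall i x, 0 <= seminorm i x ;
  seminormD : forall i x y, seminorm i (x + y) <= seminorm i x + seminorm i y ;
  seminormZ : forall i c x, seminorm i (c *: x) <= normc c * seminorm i x
}.

HB.builders Context (R : realType) E & Lmodule_isSeminormTvs R E.

Let p0 := seminorm_ge0.
Let pD := seminormD.
Let pZ := seminormZ.

HB.instance Definition _ := isUniform.Build E
  (seminorm_entourage_filter seminorm)
  (seminorm_entourage_diagonal p0 pZ) (seminorm_entourage_inv pZ)
  (seminorm_entourage_split pD).

Let nbhs_seminormP (x : E) (A : set E) :
  nbhs x A <-> exists s e, 0 < e /\ seminorm_ball seminorm s e x `<=` A.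
Proof.
rewrite -nbhs_entourageE; split.
- move=> [B [s [e [e0 sB]]] BA]; exists s, e; split => // y /sB xy.
  by apply: BA; exact/xsectionP.
- move=> [s [e [e0 sA]]].
  exists [set xy | seminorm_ball seminorm s e xy.1 xy.2]; first by exists s, e.
  by move=> y /xsectionP /sA.
Qed.

Let add_cont : continuous (fun x : E * E => x.1 + x.2).
Proof.
move=> [x y] A /nbhs_seminormP[s [e [e0 sA]]].
exists (seminorm_ball seminorm s (e / 2) x, seminorm_ball seminorm s (e / 2) y).
  by split; apply/nbhs_seminormP; exists s, (e / 2); split => //; rewrite divr_gt0.
move=> [x' y'] [/= xx yy]; apply: sA.
by rewrite (splitr e); exact: seminorm_ballD.
Qed.

Let scale_cont : continuous (fun z : R[i]^o * E => z.1 *: z.2).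
Proof.
move=> [c x] A /nbhs_seminormP[s [e [e0 sA]]].
have [M M0 sM] := seminorm_bound p0 s x.
pose d := e / 2 / M.
have d0 : 0 < d by rewrite divr_gt0 // divr_gt0.
pose h := e / 2 / (normc c + d + 1).
have cd0 : 0 < normc c + d + 1 by rewrite addr_gt0// ltr_wpDl// normc_ge0.
exists ([set c' : R[i]^o | normc (c - c') < d],
        seminorm_ball seminorm s h x).
  split => /=; last by apply/nbhs_seminormP; exists s, h; split => //; rewrite divr_gt0// divr_gt0.
  apply/nbhs_ballP; exists d%:C => /=; first by rewrite ltcR.
  by move=> c'; rewrite /ball/= normc_lt.
move=> [c' x'] [/= cc' xx']; apply: sA.
rewrite (splitr e).
apply: (seminorm_ball_trans pD (y := c' *: x)).
  rewrite [e / 2](mul_div_gt0 _ M0).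
  exact: (seminorm_ballZl p0 pZ).
rewrite [e / 2](mul_div_gt0 _ cd0) mulrC.
apply: (seminorm_ballZ p0 pZ) => //.
have -> : c' = c + - (c - c') by rewrite subKr.
rewrite (le_lt_trans (normc_leD _ _))// normc_opp -addrA ltrD2l.
by rewrite (lt_trans cc')// ltrDl.
Qed.

Let loc_convex : exists2 B : set_system E,
  (forall b, b \in B -> convex_set b) & basis B.
Proof.
exists [set A | open A /\ @convex_set _ E A].
  by move=> A; rewrite inE => -[].
split; first by move=> A [].
move=> x A /nbhs_seminormP[s [e [e0 sA]]].
exists (seminorm_ball seminorm s e x) => //; split.
  split.
    rewrite openE => y xy; apply/nbhs_seminormP.
    have : exists2 e', 0 < e' & seminorm_ball seminorm s (e - e') x y.
      move: xy {sA}; rewrite /seminorm_ball /=; elim: s => [|i s IH] /=.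
        by exists 1.
      move=> /andP[xy /IH[e' e'0 sxy]].
      exists (Num.min e' ((e - seminorm i (x - y)) / 2)).
        by rewrite lt_min e'0 divr_gt0// subr_gt0.
      apply/andP; split.
        have : Num.min e' ((e - seminorm i (x - y)) / 2) <=
          (e - seminorm i (x - y)) / 2 by rewrite ge_min lexx orbT.
        by lra.
      apply: sub_all sxy => j /lt_le_trans; apply.
      by rewrite lerD2l lerN2 ge_min lexx.
    move=> [e' e'0 xye]; exists s, e'; split => // z yz.
    by have := seminorm_ball_trans pD xye yz; rewrite subrK.
  exact: seminorm_ball_convex.
exact: (seminorm_ball_center p0 pZ).
Qed.

HB.instance Definition _ :=
  PreTopologicalNmodule_isTopologicalNmodule.Build E add_cont.
HB.instance Definition _ :=
  TopologicalNmodule_isTopologicalLmodule.Build R[i] E scale_cont.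
HB.instance Definition _ := Uniform_isTvs.Build R[i] E loc_convex.

HB.end.

Section GelfandShilov.
Context {R : realType} (d : R).

Definition omega (t : R) : R := t `^ d^-1.

Definition phi_omega (t : R) : R := omega (expR t).

(* For d > 1 the set is bounded above, so that the real-valued sup is the
   supremum. *)
Definition phi_omega_star (s : R) : R :=
  sup [set s * t - phi_omega t | t in [set t | 0 <= t]].

(* R[i] is not a normed space over R in the library: derivatives of
   complex-valued functions of a real variable are taken componentwise. *)
Definition cderiv (n : nat) (f : R -> R[i]) (x : R) : R[i] :=
  (Re \o f)^`(n)%classic x +i* (Im \o f)^`(n)%classic x.

Definition smooth (f : R -> R[i]) : Prop := forall n x,
  derivable ((Re \o f)^`(n)%classic) x 1 /\ derivable ((Im \o f)^`(n)%classic) x 1.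

Definition gs_term (lam : R) (f : R -> R[i]) (x : R) (nq : nat * nat) : R :=
  (1 + `|x|) ^+ nq.2 * normc (cderiv nq.1 f x) *
    expR (- lam * phi_omega_star ((nq.1 + nq.2)%N%:R / lam)).

Definition gs_norm (lam : R) (f : R -> R[i]) : \bar R :=
  ereal_sup (range (fun x : R =>
    ereal_sup (range (fun nq : nat * nat => (gs_term lam f x nq)%:E)))).

Definition gelfand_shilov_pred : {pred R -> R[i]} := fun f =>
  `[< smooth f /\ forall lam, 0 < lam -> (gs_norm lam f < +oo)%E >].

Record gelfand_shilov := GelfandShilov {
  gs_fun :> R -> R[i] ;
  gs_funP : gs_fun \in gelfand_shilov_pred
}.

HB.instance Definition _ := [isSub for gs_fun].
HB.instance Definition _ := [Choice of gelfand_shilov by <:].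

Lemma gs_term_ge0 lam f x nq : 0 <= gs_term lam f x nq.
Proof.
by rewrite /gs_term !mulr_ge0 ?expR_ge0 ?normc_ge0 ?exprn_ge0 ?addr_ge0.
Qed.

Lemma gs_norm_leP lam f (M : R) :
  (gs_norm lam f <= M%:E)%E <-> forall x nq, gs_term lam f x nq <= M.
Proof.
split=> [fM x nq|fM].
  rewrite -lee_fin; apply: le_trans fM.
  apply: (@le_trans _ _ (ereal_sup
    (range (fun nq : nat * nat => (gs_term lam f x nq)%:E)))).
    by apply: ereal_sup_ubound; exists nq.
  by apply: ereal_sup_ubound; exists x.
apply: ge_ereal_sup => _ [x _ <-]; apply: ge_ereal_sup => _ [nq _ <-].
by rewrite lee_fin.
Qed.

Lemma gs_norm_ge0 lam f : (0 <= gs_norm lam f)%E.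
Proof.
apply: (@le_trans _ _ (gs_term lam f 0 (0%N, 0%N))%:E).
  by rewrite lee_fin gs_term_ge0.
apply: (@le_trans _ _ (ereal_sup
    (range (fun nq : nat * nat => (gs_term lam f 0 nq)%:E)))).
  by apply: ereal_sup_ubound; exists (0%N, 0%N).
by apply: ereal_sup_ubound; exists 0.
Qed.

Let der_lin (u v : R -> R) (a b : R) n :
  (forall n x, derivable (derive1n n u) x 1) -> (forall n x, derivable (derive1n n v) x 1) ->
  derive1n n (a \*: u + b \*: v) = a \*: (derive1n n u) + b \*: (derive1n n v).
Proof.
move=> du dv; elim: n => [//|n IH].
rewrite !derive1nS IH; apply/funext => x.
rewrite derive1E deriveD; try exact: derivableZ.
by rewrite !deriveZ// !fctE /= !derive1E.
Qed.

Let Re_lin (c : R[i]) (f g : R -> R[i]) : Re \o (c *: f + g) =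
  (Re c \*: (Re \o f) + (- Im c) \*: (Im \o f)) + (Re \o g).
Proof.
apply/funext => x; rewrite !fctE /=.
by case: c (f x) (g x) => [a b] [u v] [w z] /=; rewrite scaleNr.
Qed.

Let Im_lin (c : R[i]) (f g : R -> R[i]) : Im \o (c *: f + g) =
  (Im c \*: (Re \o f) + Re c \*: (Im \o f)) + (Im \o g).
Proof.
apply/funext => x; rewrite !fctE /=.
by case: c (f x) (g x) => [a b] [u v] [w z] /=; rewrite [a * v + _]addrC.
Qed.

Let der_linD (u v w : R -> R) (a b : R) n :
  (forall n x, derivable (derive1n n u) x 1) ->
  (forall n x, derivable (derive1n n v) x 1) ->
  (forall n x, derivable (derive1n n w) x 1) ->
  derive1n n (a \*: u + b \*: v + w) =
  a \*: derive1n n u + b \*: derive1n n v + derive1n n w.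
Proof.
move=> du dv dw.
have linD (f g : R -> R) : f + g = 1 \*: f + 1 \*: g.
  by apply/funext => x; rewrite !fctE /= !scale1r.
rewrite [X in derive1n n X]linD der_lin//; last first.
  by move=> k x; rewrite der_lin//; apply: derivableD; exact: derivableZ.
by rewrite der_lin// -linD.
Qed.

Lemma smooth_lin (c : R[i]) f g : smooth f -> smooth g -> smooth (c *: f + g).
Proof.
move=> sf sg n x.
have sRf k y := (sf k y).1; have sIf k y := (sf k y).2.
have sRg k y := (sg k y).1; have sIg k y := (sg k y).2.
rewrite Re_lin Im_lin !der_linD//; split;
  by do 2?[apply: derivableD => //]; exact: derivableZ.
Qed.

Lemma cderiv_lin (c : R[i]) f g n x : smooth f -> smooth g ->
  cderiv n (c *: f + g) x = c * cderiv n f x + cderiv n g x.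
Proof.
move=> sf sg.
have sRf k y := (sf k y).1; have sIf k y := (sf k y).2.
have sRg k y := (sg k y).1; have sIg k y := (sg k y).2.
rewrite /cderiv Re_lin Im_lin !der_linD// !fctE /=.
case: c => a b; simpc; rewrite scaleNr; congr (_ +i* (_ + _)).
by rewrite addrC.
Qed.

Lemma gs_term_lin lam (c : R[i]) f g x nq : smooth f -> smooth g ->
  gs_term lam (c *: f + g) x nq <=
  normc c * gs_term lam f x nq + gs_term lam g x nq.
Proof.
move=> sf sg; rewrite /gs_term cderiv_lin//.
rewrite mulrA -mulrDl ler_wpM2r ?expR_ge0// mulrCA -mulrDr.
by rewrite ler_wpM2l ?exprn_ge0 ?addr_ge0// -normc_mul normc_leD.
Qed.

Lemma smooth0 : smooth 0.
Proof.
have D0 n : derive1n n (0 : R -> R) = 0.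
  elim: n => [//|n IH]; rewrite derive1nS IH.
  by apply/funext => x; rewrite derive1_cst.
move=> n x; rewrite (_ : Re \o 0 = 0)// (_ : Im \o 0 = 0)// !D0.
by split; exact: derivable_cst.
Qed.

Lemma gs_norm_lin lam (c : R[i]) f g M N : smooth f -> smooth g ->
  (gs_norm lam f <= M%:E)%E -> (gs_norm lam g <= N%:E)%E ->
  (gs_norm lam (c *: f + g)%R <= (normc c * M + N)%:E)%E.
Proof.
move=> sf sg /gs_norm_leP fM /gs_norm_leP gN; apply/gs_norm_leP => x nq.
rewrite (le_trans (gs_term_lin _ _ _ _ sf sg))// lerD// ler_wpM2l//.
exact: normc_ge0.
Qed.

Lemma gs_norm0 lam : (gs_norm lam 0%R <= 0%:E)%E.
Proof.
apply/gs_norm_leP => x nq; rewrite /gs_term.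
have -> : cderiv nq.1 0 x = 0.
  have /(_ (-1)) := @cderiv_lin _ 0 0 nq.1 x smooth0 smooth0.
  by rewrite scaler0 addr0 mulN1r addNr.
by rewrite ComplexField.Normc.normc0 mulr0 mul0r.
Qed.

Lemma gs_norm_fineK lam (f : gelfand_shilov) :
  0 < lam -> ((fine (gs_norm lam f))%:E = gs_norm lam f)%E.
Proof.
case: f => f /= /asboolP[_ /(_ lam)] flam /flam {}flam.
by rewrite fineK// ge0_fin_numE// gs_norm_ge0.
Qed.

Lemma gelfand_shilov_submod_closed : submod_closed gelfand_shilov_pred.
Proof.
split.
  apply/asboolP; split; first exact: smooth0.
  by move=> lam lam0; rewrite (le_lt_trans (gs_norm0 lam))// ltry.
move=> c f g fP gP; apply/asboolP.
have /asboolP[sf ff] := fP; have /asboolP[sg gg] := gP.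
split; first exact: smooth_lin.
move=> lam lam0.
have fK := gs_norm_fineK (GelfandShilov fP) lam0.
have gK := gs_norm_fineK (GelfandShilov gP) lam0.
apply: le_lt_trans (ltry _); apply: (gs_norm_lin c sf sg).
  by rewrite -fK.
by rewrite -gK.
Qed.

HB.instance Definition _ :=
  GRing.isSubmodClosed.Build R[i] (R -> R[i]) gelfand_shilov_pred
    gelfand_shilov_submod_closed.
HB.instance Definition _ :=
  [SubChoice_isSubLmodule of gelfand_shilov by <:].

Definition gs_seminorm (lam : {posnum R}) (f : gelfand_shilov) : R :=
  fine (gs_norm lam%:num f).

Let gs_seminorm_ge0 lam f : 0 <= gs_seminorm lam f.
Proof. by rewrite fine_ge0// gs_norm_ge0. Qed.

Let gs_seminorm_lin lam c f g : gs_seminorm lam (c *: f + g) <=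
  normc c * gs_seminorm lam f + gs_seminorm lam g.
Proof.
have /asboolP[sf _] := gs_funP f; have /asboolP[sg _] := gs_funP g.
rewrite -lee_fin gs_norm_fineK//.
by apply: gs_norm_lin; rewrite // gs_norm_fineK.
Qed.

Let gs_seminormD lam f g :
  gs_seminorm lam (f + g) <= gs_seminorm lam f + gs_seminorm lam g.
Proof.
have := gs_seminorm_lin lam 1 f g.
by rewrite scale1r ComplexField.Normc.normc1 mul1r.
Qed.

Let gs_seminormZ lam c f :
  gs_seminorm lam (c *: f) <= normc c * gs_seminorm lam f.
Proof.
have := gs_seminorm_lin lam c f 0; rewrite addr0.
suff -> : gs_seminorm lam 0 = 0 by rewrite addr0.
apply/eqP; rewrite eq_le gs_seminorm_ge0 andbT.
by rewrite -lee_fin gs_norm_fineK// gs_norm0.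
Qed.

HB.instance Definition _ := Lmodule_isSeminormTvs.Build R gelfand_shilov
  gs_seminorm_ge0 gs_seminormD gs_seminormZ.

Lemma gs_entourageE :
  @entourage gelfand_shilov = seminorm_entourage gs_seminorm.
Proof. by []. Qed.

End GelfandShilov.

Section CompositionOperator.
Context {R : realType} (d : R) (psi : {poly R}).

Definition comp_dom : set (gelfand_shilov d) :=
  [set f | (fun x => f psi.[x]) \in gelfand_shilov_pred d].

Definition comp_op (f : comp_dom) : gelfand_shilov d :=
  GelfandShilov (set_mem (valP f)).

Lemma comp_dom_linear (c : R[i]) (f g : gelfand_shilov d) :
  comp_dom f -> comp_dom g -> comp_dom (c *: f + g).
Proof.
move=> fD gD.
have /= := valP (c *: GelfandShilov fD + GelfandShilov gD).
by rewrite /comp_dom.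
Qed.

Lemma comp_op_linear (c : R[i]) (f g h : comp_dom) :
  val h = c *: val f + val g -> comp_op h = c *: comp_op f + comp_op g.
Proof. by move=> hE; apply/val_inj; rewrite /= hE. Qed.

End CompositionOperator.

(* Main.v *)
Require Import Defs.
From mathcomp Require Import all_boot all_order all_algebra.
From mathcomp Require Import all_classical all_reals all_analysis.
From mathcomp Require Import complex.
From mathcomp Require Import polyorder polyrcf ring lra.
Import Order.TTheory GRing.Theory Num.Theory.
Import numFieldNormedType.Exports.
Local Open Scope classical_set_scope.
Local Open Scope ring_scope.
Local Open Scope complex_scope.

(* Every l with |l| >= 1 fails to lie in rho(A), so sigma^*(A) is unbounded.

   Up to the reflection x -> -x, psi tends to +oo at +oo. If S = (l - A)^-1
   and u = S f with f supported in [N - 1, N + 1], then l u - u o psi = f and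
   the decay of u at infinity force u = 0 beyond N + 1, hence u = l^-2 f o psi
   at the points x near +oo with psi(x) close to N. Take for f a fixed Gevrey
   bump of order 2 times cos (pi N (x - N)): since d > 2, all its seminorms in
   Sigma_d are O(exp (c N^(1/d))). On the other hand psi' >= k sqrt psi, so
   l^2 u alternates in sign at n + 1 points (n <= N / 2) lying in an interval of
   length O(n / N^(3/2)), and n applications of the mean value theorem produce a
   value of the n-th derivative of size (N^(3/2) / (C n))^n. For n of order
   N^(1/b), with 2(d+1)/3 < b < d, this beats n^(dn) exp (c N^(1/d)), against
   the continuity of S. *)

Set Implicit Arguments.
Unset Strict Implicit.
Unset Printing Implicit Defensive.

Local Notation normc := complex.ComplexField.Normc.normc.

(** * Alternating functions, and derivative bounds for wave packets *)

Section RealDerivatives.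
Context {R : realType}.
Implicit Types (f g : R -> R) (x y : R) (n : nat).

Lemma nondecreasing_of_step (x : nat -> R) :
  (forall i, x i < x i.+1) -> forall i j, (i <= j)%N -> x i <= x j.
Proof.
move=> xS; have /nondecreasing_seqP xm : forall k, x k <= x k.+1 by move=> k; exact: ltW.
by move=> i j; exact: xm.
Qed.

Lemma MVT_derivable f x y : (forall z, derivable f z 1) -> x < y ->
  exists2 c, x < c < y & f y - f x = f^`()%classic c * (y - x).
Proof.
move=> df xy.
have [||c] := @MVT R f (f^`()%classic) x y xy.
- by move=> z _; rewrite derive1E; exact/derivableP.
- by apply: derivable_within_continuous => z _; exact: df.
- by rewrite in_itv /= => xcy e; exists c.
Qed.

(** Each gap between nodes is at most L, so the mean value points between consecutive nodes carry
    slopes of alternating sign and of size at least 2 a / L. They interlace with the nodes, hence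
    again spread over at most L, and the induction runs on f'. *)
Lemma alternation_derive1n n f (x : nat -> R) (s : bool) (a L : R) :
  (forall k z, derivable (derive1n k f) z 1) ->
  (forall i, x i < x i.+1) -> 0 < L -> x n - x 0%N <= L -> 0 <= a ->
  (forall i, (i <= n)%N -> a <= (-1) ^+ (i + s) * f (x i)) ->
  exists z, a * (2 / L) ^+ n <= `|derive1n n f z|.
Proof.
elim: n f x s a => [|n IH] f x s a df xS L0 xL a0 fa.
  exists (x 0%N); rewrite expr0 mulr1 (le_trans (fa 0%N isT))//.
  by rewrite (le_trans (ler_norm _))// normrM normrX normrN1 expr1n mul1r.
have [y yP] : {y : nat -> R & forall i, x i < y i < x i.+1 /\
    f (x i.+1) - f (x i) = f^`()%classic (y i) * (x i.+1 - x i)}.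
  apply: (@choice _ _ (fun i z => x i < z < x i.+1 /\
    f (x i.+1) - f (x i) = f^`()%classic z * (x i.+1 - x i))) => i.
  by have [c ? ?] := @MVT_derivable f _ _ (df 0%N) (xS i); exists c.
have yx i : x i < y i by have [/andP[]] := yP i.
have xy i : y i < x i.+1 by have [/andP[]] := yP i.
have xm := nondecreasing_of_step xS.
have [|||||i lein|z zP] := IH (f^`()%classic) y (~~ s) (a * (2 / L)).
- by move=> k z; rewrite -derive1Sn; exact: df.
- by move=> i; rewrite (lt_trans (xy i)).
- exact: L0.
- rewrite (le_trans _ xL)// lerB// ltW//; by [exact: xy|exact: yx].
- by rewrite mulr_ge0// divr_ge0// ltW.
- have /= gapL : x i.+1 - x i <= L.
    by rewrite (le_trans _ xL)// lerB// xm// ltnS.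
  have gap0 : 0 < x i.+1 - x i by rewrite subr_gt0.
  have fS : 2 * a <= (-1) ^+ (i + ~~ s) * (f (x i.+1) - f (x i)).
    have := fa i.+1 lein; have := fa i (leqW lein).
    by rewrite !exprD exprS; case: (s) => /=; rewrite ?expr0 ?expr1; lra.
  move: fS; rewrite (yP i).2 mulrA; set D := _ * f^`()%classic _ => fS.
  have D0 : 0 <= D by rewrite -(pmulr_lge0 _ gap0) (le_trans _ fS)// mulr_ge0.
  rewrite mulrA ler_pdivrMr// mulrC (le_trans fS)//.
  by rewrite ler_wpM2l.
- by exists z; rewrite derive1Sn exprS mulrA.
Qed.

(** The index j makes the family stable under differentiation: the derivative combines the indices j
    + 1 and j + 2. *)
Definition flat_exp (j : nat) (x : R) : R :=
  if 0 < x then x^-1 ^+ j * expR (- x^-1) else 0.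

Lemma flat_exp_ge0 j x : 0 <= flat_exp j x.
Proof.
rewrite /flat_exp; case: ifP => // x0.
by rewrite mulr_ge0 ?expR_ge0// exprn_ge0// invr_ge0 ltW.
Qed.

Lemma expX_le_fact j x : 0 <= x -> x ^+ j * expR (- x) <= j`!%:R.
Proof.
move=> x0; rewrite expRN ler_pdivrMr ?expR_gt0//.
case: j => [|j]; first by rewrite expr0 fact0 mul1r -expR0 ler_expR.
have := expR_ge1Dxn j x0.
have f0 : 0 < (j.+1)`!%:R :> R by rewrite ltr0n fact_gt0.
move=> H; rewrite -ler_pdivrMl// mulrC (le_trans _ H)// lerDr//.
Qed.

Lemma flat_exp_le_fact j x : flat_exp j x <= j`!%:R.
Proof.
rewrite /flat_exp; case: ifP => // x0.
by apply: expX_le_fact; rewrite invr_ge0 ltW.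
Qed.

Lemma flat_exp_shift j x : flat_exp j x = flat_exp j.+1 x * x.
Proof.
rewrite /flat_exp; case: ifPn => x0; last by rewrite mul0r.
by rewrite exprS mulrC; field; rewrite gt_eqF.
Qed.

Lemma flat_exp_cvg0 j : flat_exp j x @[x --> 0] --> flat_exp j 0.
Proof.
have -> : flat_exp j 0 = 0 by rewrite /flat_exp ltxx.
apply/norm_cvg0P; apply: (@squeeze_cvgr _ _ _ _ (cst 0) (fun x : R => (j.+1)`!%:R * `|x|)).
- near=> x; rewrite normr_ge0 flat_exp_shift normrM ger0_norm ?flat_exp_ge0//=.
  by rewrite ler_wpM2r// flat_exp_le_fact.
- exact: cvg_cst.
- rewrite -[X in _ --> X](mulr0 (j.+1)`!%:R); apply: cvgMr.
  by rewrite -[X in _ --> X](normr0 R); apply: cvg_norm; exact: cvg_id.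
Unshelve. all: by end_near. Qed.

Lemma is_derive_flat_exp j x : is_derive x 1 (flat_exp j)
  (flat_exp j.+2 x - j%:R * flat_exp j.+1 x).
Proof.
have [x0|x0|->] := ltgtP x 0.
- rewrite /flat_exp ltNge (ltW x0) /= mulr0 subr0.
  apply: (@near_eq_is_derive _ _ _ (cst 0)) => //.
  near=> y; rewrite ltNge ifN // negbK ltW//.
  by near: y; exact: lt_nbhsl.
- rewrite /flat_exp x0.
  apply: (@near_eq_is_derive _ _ _ ((GRing.inv ^+ j) * (expR \o (-%R \o GRing.inv)))) => //.
    near=> y; rewrite ifT ?fctE//.
    by near: y; exact: lt_nbhsr.
  have xn0 : x != 0 by rewrite gt_eqF.
  have ? := @is_deriveV R id x 1 1 xn0 (is_derive_id _ _).
  apply: is_derive_eq.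
  rewrite /GRing.scale /= !fctE /=.
  rewrite -!exprVn; move: x^-1 => z.
  case: j => [|j];  first by rewrite !mul0r !mulr0 addr0 subr0; ring.
  by rewrite /= !exprS; ring.
(* At 0, [flat_exp j.+1] is itself the slope function, by [flat_exp_shift], and it is continuous
   there. *)
- apply/(@is_derive1_caratheodory R); exists (flat_exp j.+1); split.
  + by move=> z; rewrite {2}/flat_exp ltxx !subr0 flat_exp_shift.
  + exact: flat_exp_cvg0.
  + by rewrite /flat_exp ltxx mulr0 subr0.
Unshelve. all: by end_near. Qed.

(** Derivability up to order n travels with the bound, so that derivatives of sums can be split; B
    depends on x in order to record supports. *)
Definition derive1n_le n f (B : R -> R) := forall x,
  (forall k, (k <= n)%N -> derivable (derive1n k f) x 1) /\
  `|derive1n n f x| <= B x.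

Lemma derive1n_le_step n f g B : (forall x, is_derive x 1 f (g x)) ->
  derive1n_le n g B -> derive1n_le n.+1 f B.
Proof.
move=> fg gB x.
have f'E : f^`()%classic = g by apply/funext => y; rewrite derive1E derive_val.
rewrite derive1Sn f'E; split; last exact: (gB x).2.
case=> [|k] kn; first by have [] := fg x.
by rewrite derive1Sn f'E; apply: (gB x).1.
Qed.

Lemma derive1n_le_lin n c f g B C : derive1n_le n f B -> derive1n_le n g C ->
  derive1n_le n (c \*: f + g) (fun x => `|c| * B x + C x).
Proof.
move=> fB gC.
have E k : (k <= n)%N -> derive1n k (c \*: f + g) = c \*: derive1n k f + derive1n k g.
  elim: k => [//|k IH] kn; rewrite derive1nS IH ?(ltnW kn)//.
  apply/funext => x; rewrite derive1E.
  have fk := (fB x).1 _ (ltnW kn); have gk := (gC x).1 _ (ltnW kn).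
  have := is_deriveD (is_deriveZ c (derivableP fk)) (derivableP gk).
  by case=> _ ->; rewrite -!derive1E.
move=> x; split.
  move=> k kn; rewrite (E _ kn).
  have fk := (fB x).1 _ kn; have gk := (gC x).1 _ kn.
  by have [] := is_deriveD (is_deriveZ c (derivableP fk)) (derivableP gk).
rewrite E// (le_trans (ler_normD _ _))// lerD ?(gC x).2//.
by rewrite /= normrM ler_wpM2l ?(fB x).2.
Qed.

Lemma derive1n_le_weaken n f B C : (forall x, B x <= C x) ->
  derive1n_le n f B -> derive1n_le n f C.
Proof.
by move=> BC fB x; have [? fx] := fB x; split => //; exact: le_trans (BC x).
Qed.

(** The indices and the phase parametrize a family stable under differentiation: each term of the
    derivative raises i or j by one or two, or shifts the phase by pi / 2. *)
Definition packet (xi : R) (i j : nat) (ph t : R) : R :=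
  flat_exp i (1 + t) * flat_exp j (1 - t) * cos (xi * t + ph).

Lemma is_derive_packet (xi : R) i j ph (t : R) : is_derive t 1 (packet xi i j ph)
  (((- i%:R) \*: packet xi i.+1 j ph + (j%:R \*: packet xi i j.+1 ph +
   (xi \*: packet xi i j (ph + pi / 2) + ((-1) \*: packet xi i j.+2 ph +
   packet xi i.+2 j ph)))) t).
Proof.
have h1 : is_derive t 1 (cst 1 + id) (0 + 1 : R) by apply: is_deriveD.
have h2 : is_derive t 1 (cst 1 - id) (0 - 1 : R) by apply: is_deriveB.
have h3 : is_derive t 1 (xi \*: id + cst ph) (xi *: 1 + 0 : R).
  by apply: is_deriveD.
have d1 := @is_derive1_comp _ _ (fun t => 1 + t) _ _ _ (is_derive_flat_exp i (1 + t)) h1.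
have d2 := @is_derive1_comp _ _ (fun t => 1 - t) _ _ _ (is_derive_flat_exp j (1 - t)) h2.
have d3 := @is_derive1_comp _ _ (fun t => xi * t + ph) _ _ _ (is_derive_cos (xi * t + ph)) h3.
have := @is_deriveM _ _ _ _ _ _ _ _ (@is_deriveM _ _ _ _ _ _ _ _ d1 d2) d3.
set D := (X in is_derive _ _ _ X).
suff -> : D = ((- i%:R) \*: packet xi i.+1 j ph + (j%:R \*: packet xi i j.+1 ph +
   (xi \*: packet xi i j (ph + pi / 2) + ((-1) \*: packet xi i j.+2 ph +
   packet xi i.+2 j ph)))) t by [].
rewrite /D /packet !fctE /= /GRing.scale /= [xi * t + (ph + _)]addrA cosDpihalf; ring.
Qed.

(* The term 3 (s + 2n)^2 is chosen so that the recursion packet_bound_step,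
   which mirrors is_derive_packet, closes up. *)
Definition packet_bound (xi : R) n s : R :=
  (xi + 3 * (s + n.*2)%:R ^+ 2) ^+ n * s`!%:R.

(** Here s stands for i + j and t for i. All bases are at most the one of order n + 1, because s + 2
    + 2 n = s + 2 (n + 1); the rest follows from 2 (s + 1) (s + 2) + s (s + 1) <= 3 (s + 2)^2. *)
Lemma packet_bound_step (xi : R) n s t : 0 <= xi -> (t <= s)%N ->
  t%:R * packet_bound xi n s.+1 + ((s - t)%:R * packet_bound xi n s.+1 +
   (xi * packet_bound xi n s + (packet_bound xi n s.+2 + packet_bound xi n s.+2)))
  <= packet_bound xi n.+1 s.
Proof.
move=> xi0 ts; rewrite addrA -mulrDl -natrD subnKC//.
rewrite /packet_bound; set Q := (s + n.+1.*2)%:R.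
set A := (xi + _) ^+ n.+1.
have mono k : (k <= s.+2 + n.*2)%N -> (xi + 3 * k%:R ^+ 2) ^+ n <= (xi + 3 * Q ^+ 2) ^+ n.
  move=> kQ; rewrite lerXn2r ?nnegrE ?addr_ge0 ?mulr_ge0 ?sqr_ge0//.
  rewrite lerD2l ler_pM2l// lerXn2r ?nnegrE// ler_nat.
  by rewrite doubleS !addnS -addSn -addSn.
set M := (xi + 3 * Q ^+ 2) ^+ n in mono.
have M0 : 0 <= M by rewrite exprn_ge0// addr_ge0// mulr_ge0// sqr_ge0.
have b1 := mono _ (leqnSn (s.+1 + n.*2)).
have b2 := mono _ (leqnn (s.+2 + n.*2)).
have b0 : (xi + 3 * (s + n.*2)%:R ^+ 2) ^+ n <= M.
  by apply: mono; rewrite leq_add2r -addn2 leq_addr.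
have S0 : 0 <= s`!%:R :> R by [].
have f1 : s.+1`!%:R = (s%:R + 1) * s`!%:R :> R by rewrite factS natrM -natr1.
have f2 : s.+2`!%:R = (s%:R + 2) * ((s%:R + 1) * s`!%:R) :> R.
  by rewrite factS natrM f1 -natr1 -natr1; congr (_ * _); ring.
apply: (@le_trans _ _ (M * s`!%:R * (xi + 2 * ((s%:R + 1) * (s%:R + 2)) + s%:R * (s%:R + 1)))).
  have -> : M * s`!%:R * (xi + 2 * ((s%:R + 1) * (s%:R + 2)) + s%:R * (s%:R + 1)) =
    s%:R * (M * s.+1`!%:R) + (xi * (M * s`!%:R) + (M * s.+2`!%:R + M * s.+2`!%:R)).
    by rewrite f1 f2; ring.
  by rewrite !lerD// ?ler_wpM2l// ler_wpM2r.
rewrite /A exprSr -/M mulrAC ler_wpM2r// ler_wpM2l//.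
have : s%:R + 2 <= Q by rewrite -natrD ler_nat doubleS !addnS addn0 !ltnS leq_addr.
have : 0 <= s%:R :> R by [].
by move: s%:R => z z0 zQ; nra.
Qed.

(** At i = j = 0 the bound is (xi + 12 n^2)^n, that is, Gevrey growth of order 2 in n. One of the
    flat factors vanishes as soon as |x| >= 1. *)
Lemma packet_derive1n_le (xi : R) n i j ph : 0 <= xi ->
  derive1n_le n (packet xi i j ph)
    (fun x => if `|x| < 1 then packet_bound xi n (i + j) else 0).
Proof.
move=> xi0; elim: n i j ph => [|n IH] i j ph.
  move=> x; split.
    by case=> // _; have [] := is_derive_packet xi i j ph x.
  rewrite /= /packet_bound expr0 mul1r /packet; case: ifPn => [_|].
    rewrite !normrM !(ger0_norm (flat_exp_ge0 _ _)).
    rewrite -[leRHS]mulr1 ler_pM ?mulr_ge0 ?flat_exp_ge0//; last first.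
      by rewrite ler_norml cos_geN1 cos_le1.
    apply: (@le_trans _ _ (i`!%:R * j`!%:R)).
      by rewrite ler_pM ?flat_exp_ge0 ?flat_exp_le_fact.
    (* i! j! <= (i + j)!, since a binomial coefficient is at least 1. *)
    rewrite -natrM ler_nat -[leqRHS](bin_fact (leq_addr j i)) addKn.
    by rewrite leq_pmull// bin_gt0 leq_addr.
  rewrite -leNgt ler_normr => /orP[] x1.
    by rewrite /flat_exp [0 < 1 - x]ltNge (_ : 1 - x <= 0) ?mulr0 ?mul0r ?normr0//; lra.
  by rewrite /flat_exp [0 < 1 + x]ltNge (_ : 1 + x <= 0) ?mulr0 ?mul0r ?normr0//; lra.
apply: (derive1n_le_step (is_derive_packet xi i j ph)).
have := derive1n_le_lin (- i%:R) (IH i.+1 j ph) (derive1n_le_lin j%:R (IH i j.+1 ph)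
  (derive1n_le_lin xi (IH i j (ph + pi / 2)) (derive1n_le_lin (-1) (IH i j.+2 ph)
  (IH i.+2 j ph)))).
apply: derive1n_le_weaken => x; case: ifPn => _; last by rewrite !mulr0 !addr0.
rewrite !normrN !normr_nat ger0_norm// normr1 mul1r.
have := packet_bound_step n xi0 (leq_addr j i).
by rewrite addKn !addSn !addnS.
Qed.

End RealDerivatives.

(** * The conjugate function and the weights of the seminorms *)

Section Conjugate.
Context {R : realType} (d : R).
Implicit Types s t : R.

Lemma phi_omegaE t : phi_omega d t = expR (t / d).
Proof. by rewrite /phi_omega /omega -expRM. Qed.

(** With p = s d and w = t / d, the tangent line of exp at ln p gives p w - exp w <= p ln p - p, and
    the last term is dropped. *)
Lemma young_phi_omega s t : 0 < d -> 0 <= s ->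
  s * t - phi_omega d t <= s * d * ln (s * d).
Proof.
move=> d0; rewrite le_eqVlt => /predU1P[<-|s0].
  by rewrite !mul0r sub0r oppr_le0 phi_omegaE expR_ge0.
rewrite phi_omegaE.
have p0 : 0 < s * d by rewrite mulr_gt0.
have -> : s * t = s * d * (t / d) by field; rewrite gt_eqF.
move: (s * d) (t / d) p0 => p w p0.
have := expR_ge1Dx (w - ln p).
rewrite expRD expRN lnK// ler_pdivlMr//.
have : p * ln p = ln p * p by ring.
by nra.
Qed.

Lemma phi_omega_star_le s : 0 < d -> 0 <= s ->
  phi_omega_star d s <= s * d * ln (s * d).
Proof.
move=> d0 s0; apply: ge_sup; first by exists (s * 0 - phi_omega d 0), 0 => //=.
by move=> _ [t _ <-]; exact: young_phi_omega.
Qed.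

(** Young's bound makes the set bounded above, without which [sup] would be a default value. *)
Lemma phi_omega_star_ge s t : 0 < d -> 0 <= s -> 0 <= t ->
  s * t - phi_omega d t <= phi_omega_star d s.
Proof.
move=> d0 s0 t0; apply: ub_le_sup; last by exists t.
by exists (s * d * ln (s * d)) => _ [u _ <-]; exact: young_phi_omega.
Qed.

(** The supremum is tested at the single point t = ln y; the free y is later matched to the size of
    the derivatives being weighted. *)
Lemma expR_phi_omega_star_le (lam s y : R) : 0 < d -> 0 < lam -> 0 <= s -> 1 <= y ->
  expR (- lam * phi_omega_star d (s / lam)) <= y `^ (- s) * expR (lam * y `^ d^-1).
Proof.
move=> d0 lam0 s0 y1; have y0 : 0 < y by rewrite (lt_le_trans _ y1).
have := @phi_omega_star_ge (s / lam) (ln y) d0 (divr_ge0 s0 (ltW lam0)) (ln_ge0 y1).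
rewrite phi_omegaE /powR gt_eqF// -expRD ler_expR -(ler_pM2l lam0) => H.
rewrite mulNr [d^-1 * _]mulrC mulNr.
suff : lam * (s / lam * ln y - expR (ln y / d)) = s * ln y - lam * expR (ln y / d) by lra.
by field; rewrite gt_eqF.
Qed.

(** This bounds from below the weight of the seminorm lam = 1, in which images under the resolvent
    are measured. *)
Lemma expR_phi_omega_star_ge n : 0 < d -> (0 < n)%N ->
  (((n%:R * d) `^ d) ^- n) <= expR (- 1 * phi_omega_star d (n%:R / 1)).
Proof.
move=> d0 n0; have nd : 0 < n%:R * d by rewrite mulr_gt0// ltr0n.
have := phi_omega_star_le d0 (ler0n _ n).
rewrite divr1 mulN1r => H.
rewrite expRN lef_pV2 ?posrE ?expR_gt0 ?exprn_gt0 ?powR_gt0//.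
rewrite /powR gt_eqF// -expRM_natl ler_expR (le_trans H)//.
by rewrite mulrA.
Qed.

End Conjugate.

(** * Estimates of powers and of weighted derivative bounds *)

Section Powers.
Context {R : realType}.

Lemma powR_sublinear (B r : R) : 0 <= B -> 0 <= r < 1 ->
  exists2 K : R, 0 <= K & forall m : R, 0 <= m -> B * m `^ r <= m + K.
Proof.
move=> B0 /andP[r0 r1].
(* The threshold is m^(1 - r) = B: above it B m^r <= m, and below it the value of B m^r at the
   threshold suffices. *)
exists (B * (B `^ (1 - r)^-1) `^ r); first by rewrite mulr_ge0// powR_ge0.
move=> m; rewrite le_eqVlt => /predU1P[<-|m0].
  rewrite add0r ler_wpM2l// ge0_ler_powR ?nnegrE ?powR_ge0//.
have [Bm|mB] := lerP B (m `^ (1 - r)).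
  rewrite (@le_trans _ _ m)// ?lerDl ?mulr_ge0 ?powR_ge0//.
  rewrite (@le_trans _ _ (m `^ (1 - r) * m `^ r))//.
    by rewrite ler_wpM2r// powR_ge0.
  rewrite -powRD; first by rewrite subrK powRr1 ?(ltW m0).
  by rewrite (gt_eqF m0) implybT.
apply: ler_wpDl; first exact: ltW.
have r1' : 0 < 1 - r by rewrite subr_gt0.
rewrite ler_wpM2l// ge0_ler_powR ?nnegrE ?powR_ge0 ?(ltW m0)//.
have -> : m = (m `^ (1 - r)) `^ (1 - r)^-1.
  by rewrite -powRrM mulfV ?gt_eqF// powRr1 ?(ltW m0).
by rewrite ge0_ler_powR ?nnegrE ?powR_ge0 ?invr_ge0 ?(ltW r1') ?(ltW mB).
Qed.

Lemma powRD_le (x y r : R) : 0 <= r -> 0 <= x -> 0 <= y ->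
  (x + y) `^ r <= 2 `^ r * (x `^ r + y `^ r).
Proof.
move=> r0 x0 y0.
wlog xy : x y x0 y0 / x <= y.
  by move=> H; have [/H|/ltW/H] := leP x y; [exact|rewrite addrC [X in _ * X]addrC; exact].
apply: (@le_trans _ _ ((2 * y) `^ r)).
  by rewrite ge0_ler_powR ?nnegrE ?addr_ge0 ?mulr_ge0//; lra.
by rewrite powRM// ler_wpM2l ?powR_ge0// lerDr powR_ge0.
Qed.

(** With M = n + q and Z = N + M^2 both bases are at most 12 Z, so y = 12 e Z in
    [expR_phi_omega_star_le] leaves exp (-M) times exp (lam y^(1/d)). The last exponent is O(N^(1/d)
    + M^(2/d)), and as 2 / d < 1 the factor exp (-M) absorbs its second term up to a constant. *)
Lemma packet_weight_le (d lam : R) : 2 < d -> 0 < lam ->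
  exists K c : R, [/\ 0 < K, 0 <= c & forall N n q : nat, (0 < N)%N ->
    (3 * N%:R) ^+ q * (pi * N%:R + 3 * (n.*2)%:R ^+ 2) ^+ n *
      expR (- lam * phi_omega_star d ((n + q)%:R / lam)) <=
    K * expR (c * N%:R `^ d^-1)].
Proof.
move=> d2 lam0; have d0 : 0 < d by lra.
have r0 : 0 <= d^-1 by rewrite invr_ge0 ltW.
pose b : R := 12 * expR 1.
have b0 : 0 < b by rewrite mulr_gt0 ?expR_gt0.
pose c : R := lam * (b `^ d^-1 * 2 `^ d^-1).
have c0 : 0 <= c by rewrite !mulr_ge0 ?powR_ge0// ltW.
have [|K0 K00 HK] := @powR_sublinear c (2 * d^-1) c0.
  by rewrite mulr_ge0//= ltr_pdivrMr ?mul1r.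
exists (expR K0), c; split; [exact: expR_gt0|exact: c0|] => N n q N0.
have N1 : 1 <= N%:R :> R by rewrite ler1n.
set M := (n + q)%N.
pose Z : R := N%:R + M%:R ^+ 2.
have Z1 : 1 <= Z by rewrite /Z -[leLHS]addr0 lerD// sqr_ge0.
have b1 : 1 <= b by rewrite /b; have := expR_ge1Dx (1 : R); lra.
have bZ : 1 <= b * Z by rewrite (le_trans b1)// ler_peMr// ltW.
have bZ0 : 0 < b * Z by exact: lt_le_trans bZ.
have Z0 : 0 <= Z by exact: le_trans Z1.
have Z12 : 0 <= 12 * Z by rewrite mulr_ge0.
apply: (@le_trans _ _ ((12 * Z) ^+ M * ((b * Z) `^ (- M%:R) * expR (lam * (b * Z) `^ d^-1)))).
  apply: ler_pM.
  - rewrite mulr_ge0 ?exprn_ge0 ?mulr_ge0// addr_ge0 ?mulr_ge0 ?sqr_ge0 ?pi_ge0//.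
  - exact: expR_ge0.
  - rewrite /M exprD mulrC ler_pM ?exprn_ge0 ?addr_ge0 ?mulr_ge0 ?sqr_ge0 ?pi_ge0//.
      have a0 : 0 <= pi * N%:R + 3 * (n.*2)%:R ^+ 2 :> R.
        by rewrite addr_ge0 ?mulr_ge0 ?sqr_ge0 ?pi_ge0.
      rewrite lerXn2r ?nnegrE//.
      have : (n.*2)%:R = 2 * n%:R :> R by rewrite -mul2n natrM.
      have : n%:R ^+ 2 <= M%:R ^+ 2 :> R.
        by rewrite lerXn2r ?nnegrE// ler_nat leq_addr.
      have : pi * N%:R <= 4 * N%:R :> R.
        by rewrite ler_wpM2r//; have [/andP[_]] := @pihalf_02_cos_pihalf R; lra.
      rewrite /Z => h1 h2 ->; nra.
    rewrite lerXn2r ?nnegrE ?mulr_ge0//.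
    have := sqr_ge0 (M%:R : R); rewrite /Z; lra.
  - exact: expR_phi_omega_star_le.
rewrite mulrA.
have -> : (12 * Z) ^+ M * (b * Z) `^ (- M%:R) = expR (- M%:R).
  have -> : b * Z = expR 1 * (12 * Z) by rewrite /b; ring.
  have : 0 < 12 * Z by rewrite mulr_gt0// (lt_le_trans _ Z1).
  move: (12 * Z) => z z0.
  rewrite powRN powR_mulrn ?mulr_ge0 ?expR_ge0 ?(ltW z0)//.
  rewrite exprMn invfM mulrCA mulfV ?mulr1 ?expf_neq0 ?gt_eqF//.
  by rewrite -expRM_natl mulr1 expRN.
rewrite -!expRD ler_expR.
have := HK M%:R (ler0n _ _).
have -> : M%:R `^ (2 * d^-1) = (M%:R ^+ 2) `^ d^-1 by rewrite powRrM powR_mulrn.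
have : lam * (b * Z) `^ d^-1 <= c * (N%:R `^ d^-1 + (M%:R ^+ 2) `^ d^-1).
  rewrite /c -mulrA ler_pM2l// powRM ?(ltW b0)//.
  rewrite -mulrA ler_wpM2l ?powR_ge0// powRD_le// sqr_ge0//.
by rewrite mulrDr; lra.
Qed.

End Powers.

(** * Modulated bumps around N or -N *)

Section TestFunctions.
Context {R : realType}.

Lemma derive1n_comp_affine (f : R -> R) (a b : R) n :
  (forall k x, derivable (derive1n k f) x 1) ->
  derive1n n (fun x => f (a * x + b)) =
    (fun x => a ^+ n * derive1n n f (a * x + b)) /\
  forall x, derivable (derive1n n (fun x => f (a * x + b))) x 1.
Proof.
move=> df.
have D k (x : R) : is_derive x 1 (fun x => a ^+ k * derive1n k f (a * x + b))
    (a ^+ k.+1 * derive1n k.+1 f (a * x + b)).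
  have h : is_derive x 1 (a \*: id + cst b) (a *: 1 + 0 : R) by apply: is_deriveD.
  have h' := derivableP (df k (a * x + b)).
  have h'' := is_deriveZ (a ^+ k) (@is_derive1_comp _ _ (fun x => a * x + b) _ _ _ h' h).
  apply: is_derive_eq; rewrite derive1nS derive1E exprSr /GRing.scale /=; ring.
have E k : derive1n k (fun x => f (a * x + b)) =
    (fun x => a ^+ k * derive1n k f (a * x + b)).
  elim: k => [|k IH]; first by apply/funext => x; rewrite /= mul1r.
  by rewrite derive1nS IH; apply/funext => x; rewrite derive1E; have [_ ->] := D k x.
by rewrite E; split => // x; have [] := D n x.
Qed.

Lemma derive1n_cst0 n : derive1n n (cst 0 : R -> R) = cst 0.
Proof.
by elim: n => // n IH; rewrite derive1nS IH; apply/funext => x; rewrite derive1_cst.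
Qed.

(* The sign (-1)^s lets the bump sit near N or near -N. *)
Definition test_fun (s : bool) (N : nat) (x : R) : R :=
  packet (pi * N%:R) 0 0 0 ((-1) ^+ s * x - N%:R).

Lemma test_fun_derive1n s N n x :
  derivable (derive1n n (test_fun s N)) x 1 /\
  `|derive1n n (test_fun s N) x| <=
    if `|(-1) ^+ s * x - N%:R| < 1 then packet_bound (pi * N%:R) n 0 else 0.
Proof.
have xi0 : 0 <= pi * N%:R :> R by rewrite mulr_ge0 ?pi_ge0.
have sm k (y : R) : derivable (derive1n k (packet (pi * N%:R) 0 0 0)) y 1.
  exact: (packet_derive1n_le k 0 0 0 xi0 y).1 k (leqnn k).
have [E D] := derive1n_comp_affine ((-1) ^+ s) (- N%:R) n sm.
split; first exact: D.
rewrite /test_fun E normrM !normrX normrN1 !expr1n mul1r.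
exact: (packet_derive1n_le n 0 0 0 xi0 _).2.
Qed.

Lemma smooth_test_fun s N : smooth (fun x => (test_fun s N x)%:C).
Proof.
move=> n x; split; first exact: (test_fun_derive1n s N n x).1.
rewrite (_ : @complex.Im R \o _ = cst 0) ?derive1n_cst0//; exact: derivable_cst.
Qed.

Lemma normc_cderiv_test_fun s N n x :
  normc (cderiv n (fun x => (test_fun s N x)%:C) x) =
  `|derive1n n (test_fun s N) x|.
Proof.
rewrite /cderiv /= (_ : @complex.Im R \o _ = cst 0)// derive1n_cst0 expr0n addr0.
by rewrite sqrtr_sqr.
Qed.

(** On the support 1 + |x| <= N + 2 <= 3 N, the base that appears in [packet_weight_le]. The
    constants do not depend on N. *)
Lemma gs_norm_test_fun (d lam : R) : 2 < d -> 0 < lam ->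
  exists K c : R, [/\ 0 < K, 0 <= c & forall s N, (0 < N)%N ->
    (gs_norm d lam (fun x => (test_fun s N x)%:C) <= (K * expR (c * N%:R `^ d^-1))%:E)%E].
Proof.
move=> d2 lam0; have [K [c [K0 c0 H]]] := packet_weight_le d2 lam0.
exists K, c; split => // s N N0; apply/gs_norm_leP => x [n q].
rewrite /gs_term normc_cderiv_test_fun /=.
have := (test_fun_derive1n s N n x).2; case: ifPn => [xN fn|_]; last first.
  rewrite normr_le0 => /eqP ->; rewrite normr0 mulr0 mul0r.
  by rewrite mulr_ge0 ?expR_ge0// ltW.
rewrite (le_trans _ (H N n q N0))// ler_wpM2r ?expR_ge0//.
move: fn; rewrite /packet_bound add0n fact0 mulr1 => fn.
rewrite ler_pM ?exprn_ge0 ?addr_ge0// lerXn2r ?nnegrE ?addr_ge0 ?mulr_ge0//.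
have N1 : 1 <= N%:R :> R by rewrite ler1n.
have : `|x| <= `|(-1) ^+ s * x - N%:R| + N%:R.
  have -> : `|x| = `|(-1) ^+ s * x - N%:R + N%:R|.
    by rewrite subrK normrM normrX normrN1 expr1n mul1r.
  by rewrite (le_trans (ler_normD _ _))// normr_nat.
lra.
Qed.

(** At N + j / N the frequency pi N turns the cosine into (-1)^j, and j <= N / 2 keeps the point at
    least 1 / 2 away from the edge of the bump, where the flat factors are at least exp (-1) and exp
    (-2). *)
Lemma packet_node (N j : nat) (t : R) : (0 < N)%N -> (j.*2 <= N)%N ->
  t = N%:R + j%:R / N%:R ->
  exists2 g : R, expR (-3) <= g & test_fun false N t = (-1) ^+ j * g.
Proof.
move=> N0 jN ->; have N0R : 0 < N%:R :> R by rewrite ltr0n.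
rewrite /test_fun expr0 mul1r addrAC subrr add0r /packet addr0.
have -> : pi * N%:R * (j%:R / N%:R) = 0 + pi *+ j :> R.
  by rewrite add0r -mulr_natr; field; rewrite gt_eqF.
rewrite alternatingn; last exact: cosDpi.
rewrite cos0 mulr1 mulrC; set r := j%:R / N%:R.
have r0 : 0 <= r by rewrite divr_ge0.
have r1 : r <= 2^-1.
  by rewrite ler_pdivrMr// mulrC ler_pdivlMr// -natrM ler_nat muln2.
exists (flat_exp 0 (1 + r) * flat_exp 0 (1 - r)) => //.
have p1 : 0 < 1 + r by lra.
have p2 : 0 < 1 - r by lra.
rewrite /flat_exp p1 p2 !expr0 !mul1r -expRD ler_expR.
have : (1 + r)^-1 <= 1 by rewrite invf_le1//; lra.
have : (1 - r)^-1 <= 2 by rewrite invf_ple ?posrE//; lra.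
lra.
Qed.

Lemma test_fun_eq0 (s : bool) (N : nat) (x : R) :
  1 <= `|(-1) ^+ s * x - N%:R| -> test_fun s N x = 0.
Proof.
move=> xN; have := (test_fun_derive1n s N 0 x).2.
by rewrite ltNge xN /= normr_le0 => /eqP.
Qed.

End TestFunctions.

(** * Growth of a polynomial near +oo and preimages of points near N *)

Section PolynomialGrowth.
Context {R : realType}.

Lemma MVT_poly (p : {poly R}) (x y : R) : x <= y ->
  exists2 c, x <= c <= y & p.[y] - p.[x] = p^`().[c] * (y - x).
Proof.
move=> xy.
have [|c] := @MVT_segment R (horner p) (horner p^`()) x y xy.
- by apply: derivable_within_continuous => z _; exact: derivable_horner.
- by rewrite in_itv /= => xcy e; exists c.
Qed.

(** That p' dominates sqrt p is what makes the preimage of an interval near N short. For a quadratic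
    p the difference p'^2 - 4 a p is constant, whence the auxiliary q below. *)
Lemma polynomial_growth (p : {poly R}) : (2 < size p)%N -> 0 < lead_coef p ->
  exists a X : R, [/\ 0 < a, 0 <= X & forall x, X <= x ->
    [/\ x + 2 <= p.[x], 0 <= p^`().[x] & a * p.[x] <= p^`().[x] ^+ 2]].
Proof.
move=> sp lp; set a := lead_coef p in lp *.
have lq : lead_coef (p - ('X + 2%:P)) = a.
  by rewrite lead_coefDl// size_polyN size_XaddC.
have [X1 H1] := poly_pinfty_gt_lc (etrans (congr1 (<%R 0) lq) lp).
have l' : lead_coef p^`() = a *+ (size p).-1.
  by rewrite lead_coefE size_deriv coef_deriv prednK// -subn1 subn_gt0 ltnW.
have l'' : lead_coef p^`()^`() = a *+ (size p).-1 *+ (size p).-2.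
  rewrite lead_coefE size_deriv coef_deriv size_deriv prednK; last first.
    by rewrite -!subn1 -subnDA subn_gt0.
  by rewrite -l' lead_coefE size_deriv.
have s2 : (1 < (size p).-1)%N by rewrite -subn1 ltn_subRL.
have s3 : (0 < (size p).-2)%N by rewrite -!subn1 -subnDA subn_gt0.
have a2 : 2 * a <= lead_coef p^`()^`().
  rewrite l'' -mulrnA -[leRHS]mulr_natl ler_wpM2r ?(ltW lp)// ler_nat.
  by rewrite (leq_trans s2)// leq_pmulr.
have l'0 : 0 < lead_coef p^`() by rewrite l' pmulrn_lgt0// ltnW.
have l''0 : 0 < lead_coef p^`()^`() by rewrite (lt_le_trans _ a2)// mulr_gt0.
have [X2 H2] := poly_pinfty_gt_lc l'0.
have [X3 H3] := poly_pinfty_gt_lc l''0.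
pose q := p^`() ^+ 2 - (4 * a) *: p.
pose X := Num.max 0 (Num.max X1 (Num.max X2 X3)).
(* p'^2 - 4 a p is nondecreasing as soon as p' >= 0 and p'' >= 2 a. *)
have q' x : X <= x -> 0 <= q^`().[x].
  rewrite !ge_max => /and4P[_ _ x2 x3].
  rewrite /q derivB derivZ expr2 derivM !hornerE.
  have := H2 _ x2; have := H3 _ x3.
  by nra.
have qm x : X <= x -> q.[X] <= q.[x].
  move=> xX; have [c /andP[Xc _] E] := MVT_poly q xX.
  by rewrite -subr_ge0 E mulr_ge0 ?subr_ge0// q'.
pose C := Num.max 0 (- q.[X]).
(* Beyond this point 3 a p >= C, so p'^2 >= 4 a p - C is at least a p. *)
exists a, (X + C / (3 * a)); split => //.
  by rewrite addr_ge0 ?divr_ge0 ?mulr_ge0 ?le_max ?lexx// ltW.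
move=> x xX.
have C0 : 0 <= C by rewrite le_max lexx.
have Ca : 0 <= C / (3 * a) by rewrite divr_ge0// mulr_ge0// ltW.
have Xx : X <= x by rewrite (le_trans _ xX)// lerDl.
have X0 : 0 <= X by rewrite le_max lexx.
have := qm _ Xx; have : - q.[X] <= C by rewrite le_max lexx orbT.
have := Xx; rewrite !ge_max => /and4P[x0 /H1 + /H2 p' _].
rewrite lq /q !(hornerD, hornerN, hornerX, hornerC, hornerZ, horner_exp) => px qX qx.
have px2 : x + 2 <= p.[x] by lra.
split => //; first by rewrite (le_trans _ p')// ltW.
have : C <= 3 * a * p.[x].
  rewrite mulrC -ler_pdivrMr ?mulr_gt0//; rewrite (le_trans _ px2)//; lra.
lra.
Qed.

(** The nodes come from the intermediate value theorem. Their spread comes from p'(c) (x_n - x_0) =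
    n / N with p'(c) >= sqrt (a p(c)) >= sqrt (a N). *)
Lemma preimage_nodes (p : {poly R}) : (2 < size p)%N -> 0 < lead_coef p ->
  exists a : R, 0 < a /\ exists N0 : nat, forall N : nat, (N0 <= N)%N -> (0 < N)%N ->
  (forall z : R, N%:R <= z -> z + 2 <= p.[z]) /\
  exists x : nat -> R, [/\ forall i, p.[x i] = N%:R + i%:R / N%:R,
    forall i, x i < x i.+1, forall i, x i + 2 <= p.[x i] &
    forall n, x n - x 0%N <= n%:R / (N%:R * Num.sqrt (a * N%:R))].
Proof.
move=> sp lp; have [a [X [a0 X0 H]]] := polynomial_growth sp lp.
exists a; split => //.
(* N exceeds X, so that the growth estimates hold from N on, and p(X), so that N + i / N lies
   between p(X) and its own image under p. *)
exists (Num.truncn (Num.max X p.[X])).+1 => N N0N N0.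
have XN : Num.max X p.[X] < N%:R.
  by rewrite (lt_le_trans (truncnS_gt _))// ler_nat.
have [{}XN pXN] : X < N%:R /\ p.[X] < N%:R by move: XN; rewrite gt_max => /andP.
split; first by move=> z Nz; have [] := H z (le_trans (ltW XN) Nz).
have N0R : 0 < N%:R :> R by rewrite ltr0n.
have [x xP] : {x : nat -> R & forall i, X <= x i /\ p.[x i] = N%:R + i%:R / N%:R}.
  apply: (@choice _ _ (fun i x => X <= x /\ p.[x] = N%:R + i%:R / N%:R)) => i.
  have y0 : N%:R <= N%:R + i%:R / N%:R :> R by rewrite lerDl divr_ge0.
  have Xy : X <= N%:R + i%:R / N%:R by rewrite (le_trans (ltW XN)).
  have [py _ _] := H _ Xy.
  have [||c] := @IVT R (horner p) X (N%:R + i%:R / N%:R) (N%:R + i%:R / N%:R) Xy.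
  - exact/continuous_subspaceT/continuous_horner.
  - rewrite ge_min le_max; apply/andP; split.
      by rewrite (le_trans (ltW pXN)).
    by apply/orP; right; lra.
  - by rewrite in_itv /= => /andP[Xc _] pc; exists c.
have mono u v : X <= u -> u <= v -> p.[u] <= p.[v].
  move=> Xu uv; have [c /andP[uc cv] E] := MVT_poly p uv.
  rewrite -subr_ge0 E mulr_ge0 ?subr_ge0//.
  by have [] := H c (le_trans Xu uc).
have xS i : x i < x i.+1.
  rewrite ltNge; apply/negP => le; have := mono _ _ (xP i.+1).1 le.
  rewrite (xP i.+1).2 (xP i).2 lerD2l ler_pM2r ?invr_gt0// ler_nat.
  by rewrite ltnn.
exists x; split => //.
- by move=> i; exact: (xP i).2.
- by move=> i; have [] := H _ (xP i).1.
move=> n; have x0n := nondecreasing_of_step xS (leq0n n).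
have [c /andP[xc cx]] := MVT_poly p x0n.
have Xc := le_trans (xP 0%N).1 xc.
have [_ p'0 ap] := H c Xc.
have Npc : N%:R <= p.[c].
  by rewrite (le_trans _ (mono _ _ (xP 0%N).1 xc))// (xP 0%N).2 mul0r addr0.
have sc : Num.sqrt (a * N%:R) <= p^`().[c].
  rewrite -(ger0_norm p'0) -sqrtr_sqr ler_wsqrtr// (le_trans _ ap)//.
  by rewrite ler_wpM2l// ltW.
have s0 : 0 < Num.sqrt (a * N%:R) by rewrite sqrtr_gt0 mulr_gt0.
rewrite (xP n).2 (xP 0%N).2 mul0r addr0 addrAC subrr add0r => E.
rewrite invfM mulrA E ler_pdivlMr// mulrC.
by rewrite ler_wpM2r// subr_ge0.
Qed.

End PolynomialGrowth.

(** * Choice of the order n and of the position N *)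

Section Asymptotics.
Context {R : realType}.

(* With N ~ n^b, 2(d+1)/3 < b < d: such b exists exactly because d > 2. *)
Lemma growth_gap (d a K c : R) (N0 : nat) : 2 < d -> 0 < a -> 0 < K -> 0 <= c ->
  exists n N : nat, [/\ (0 < n)%N, (0 < N)%N, (N0 <= N)%N, (n.*2 <= N)%N &
    K * expR (c * N%:R `^ d^-1) <
    expR (-3) * (2 / (n%:R / (N%:R * Num.sqrt (a * N%:R)))) ^+ n *
      ((n%:R * d) `^ d) ^- n].
Proof.
move=> d2 a0 K0 c0; have d0 : 0 < d by lra.
(* b is the midpoint of 2 (d + 1) / 3 and d, and e = 3 b / 2 - (d + 1) is the surplus exponent of
   N^(3/2) over n^(1 + d). *)
pose b : R := (5 * d + 2) / 6.
pose e : R := (d - 2) / 4.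
have e0 : 0 < e by rewrite /e; lra.
have b2 : 2 < b by rewrite /b; lra.
have sa0 : 0 < Num.sqrt a by rewrite sqrtr_gt0.
(* Once n^e >= C1, the base of the n-th power, divided by (n d)^d, is at least exp 1. *)
pose C1 : R := expR 1 * d `^ d / (2 * Num.sqrt a).
(* As b / d < 1, the term c N^(1/d) costs only n / 2 up to a constant; the other half of n beats the
   constants gathered in C2. *)
have [||K1 K10 HK] := @powR_sublinear R (2 * (c * 2 `^ d^-1)) (b / d).
- by rewrite !mulr_ge0 ?powR_ge0.
- by apply/andP; split; [rewrite divr_ge0 /b; lra|rewrite ltr_pdivrMr// /b; lra].
pose C2 : R := 2 * (ln K + K1 / 2 + 3).
pose n := (maxn 2 (maxn N0 (maxn (Num.truncn (C1 `^ e^-1)) (Num.truncn C2)))).+1.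
have n3 : (2 < n)%N by rewrite ltnS leq_maxl.
have nN0 : (N0 <= n)%N by rewrite (leq_trans _ (leqnSn _))// !leq_max leqnn !orbT.
have nC1 : C1 `^ e^-1 <= n%:R.
  rewrite (le_trans (ltW (truncnS_gt _)))// ler_nat ltnS !leq_max leqnn ?orbT//.
have nC2 : C2 < n%:R.
  rewrite (lt_le_trans (truncnS_gt _))// ler_nat ltnS !leq_max leqnn ?orbT//.
have n0 : 0 < n%:R :> R by rewrite ltr0n.
have n1 : 1 <= n%:R :> R by rewrite ler1n.
pose N := (Num.truncn (n%:R `^ b)).+1.
have nbN : n%:R `^ b <= N%:R :> R by rewrite ltW// truncnS_gt.
have nb1 : 1 <= n%:R `^ b :> R by rewrite -[leLHS](powRr0 n%:R) ler_powR//; lra.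
have N2 : N%:R <= 2 * n%:R `^ b :> R.
  rewrite /N -natr1; have := truncn_le (n%:R `^ b : R); rewrite powR_ge0; lra.
have N0R : 0 < N%:R :> R by rewrite ltr0n.
have n2N : (n.*2 <= N)%N.
  rewrite -(ler_nat R) (le_trans _ nbN)//.
  rewrite (@le_trans _ _ (n%:R `^ 2))//; last by rewrite ler_powR// ltW.
  by rewrite powR_mulrn// -natrX ler_nat expnS expn1 -mul2n leq_mul// ltnW.
exists n, N; split => //.
  by rewrite (leq_trans nN0)// (leq_trans _ n2N)// -addnn leq_addr.
have E1 : expR 1 <= 2 / (n%:R / (N%:R * Num.sqrt (a * N%:R))) / (n%:R * d) `^ d.
  have -> : 2 / (n%:R / (N%:R * Num.sqrt (a * N%:R))) / (n%:R * d) `^ d =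
      2 * Num.sqrt a * (N%:R * Num.sqrt N%:R) / (n%:R * n%:R `^ d) / d `^ d.
    rewrite powRM// ?(ltW d0)// sqrtrM ?(ltW a0)//.
    by field; rewrite !gt_eqF ?powR_gt0 ?sqrtr_gt0.
  have C1n : C1 <= n%:R `^ e.
    have -> : C1 = (C1 `^ e^-1) `^ e.
      rewrite -powRrM mulVf ?gt_eqF// powRr1// /C1.
      by rewrite divr_ge0 ?mulr_ge0 ?expR_ge0 ?powR_ge0 ?sqrtr_ge0.
    by rewrite ge0_ler_powR ?nnegrE ?powR_ge0 ?(ltW e0).
  rewrite ler_pdivlMr ?powR_gt0//.
  have -> : expR 1 * d `^ d = C1 * (2 * Num.sqrt a).
    by rewrite /C1 divfK// mulf_neq0// gt_eqF.
  rewrite ler_pdivlMr ?mulr_gt0 ?powR_gt0// mulrAC [leRHS]mulrC.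
  rewrite ler_wpM2r ?mulr_ge0 ?sqrtr_ge0//.
  apply: (@le_trans _ _ ((n%:R `^ b) * Num.sqrt (n%:R `^ b))); last first.
    by rewrite ler_pM ?powR_ge0 ?sqrtr_ge0// ler_wsqrtr.
  rewrite -powR12_sqrt ?powR_ge0// -powRrM -powRD; last first.
    by rewrite (gt_eqF n0) implybT.
  have -> : b + b * 2^-1 = e + (1 + d) by rewrite /b /e; field.
  rewrite !powRD ?(gt_eqF n0) ?implybT// powRr1 ?(ltW n0)//.
  by rewrite ler_wpM2r// mulr_ge0// powR_ge0.
rewrite -mulrA -exprVn -exprMn.
apply: (@lt_le_trans _ _ (expR (-3) * expR 1 ^+ n)); last first.
  by rewrite ler_wpM2l ?expR_ge0// lerXn2r ?nnegrE ?expR_ge0// (le_trans _ E1)// expR_ge0.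
rewrite -expRM_natl mulr1 -expRD -[K]lnK// -expRD ltr_expR.
have E2 : c * N%:R `^ d^-1 <= (n%:R + K1) / 2.
  rewrite ler_pdivlMr// mulrC (le_trans _ (HK _ (ltW n0)))//.
  rewrite -[2 * _ * _]mulrA -[c * _ * _]mulrA ler_wpM2l// ler_wpM2l// [b / d]mulrC powRrM powRAC.
  rewrite -powRM ?powR_ge0//; apply: ge0_ler_powR; rewrite ?nnegrE ?mulr_ge0 ?powR_ge0//.
  by rewrite invr_ge0 ltW.
move: nC2; rewrite /C2; lra.
Qed.

End Asymptotics.

(** * Continuity and test functions in terms of the seminorms *)

Section GelfandShilovFacts.
Context {R : realType} (d : R).
Implicit Types f g : gelfand_shilov d.

Lemma gs_fun_smooth f : smooth f.
Proof. by have /asboolP[] := gs_funP f. Qed.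

Lemma gs_seminorm_scale (lam : {posnum R}) (c : R[i]) f :
  gs_seminorm lam (c *: f) <= normc c * gs_seminorm lam f.
Proof.
rewrite -lee_fin gs_norm_fineK// -[normc c * _]addr0.
have -> : (c *: f : R -> R[i]) = c *: (f : R -> R[i]) + 0 by rewrite addr0.
apply: (gs_norm_lin c (gs_fun_smooth f) (smooth0)); last exact: gs_norm0.
by rewrite gs_norm_fineK.
Qed.

Lemma gs_term_le_seminorm (lam : {posnum R}) f x nq :
  gs_term d lam%:num f x nq <= gs_seminorm lam f.
Proof.
apply: (@iffLR _ _ (@gs_norm_leP R d lam%:num f _)).
by rewrite /gs_seminorm gs_norm_fineK.
Qed.

(** This is continuity at 0 read through entourages. Balls are defined by differences x - y, so
    around 0 the point to test is -f. *)
Lemma continuous_linear_gs (S : gelfand_shilov d -> gelfand_shilov d)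
    (mu : {posnum R}) : continuous_linear S ->
  exists (s : seq {posnum R}) (e : R), 0 < e /\
    forall f, all (fun lam => gs_seminorm lam f < e) s -> gs_seminorm mu (S f) < 1.
Proof.
move=> [linS ctsS].
have S0 : S 0 = 0.
  by have := linS (-1) 0 0; rewrite scaler0 addr0 => {1}->; rewrite scaleN1r addNr.
pose V : set (gelfand_shilov d * gelfand_shilov d) :=
  [set xy | gs_seminorm mu (xy.1 - xy.2) < 1].
have entV : entourage V.
  rewrite gs_entourageE; exists [:: mu], 1; split => // x y.
  by rewrite /seminorm_ball /= andbT.
have : nbhs (0 : gelfand_shilov d) (S @^-1` xsection V (S 0)).
  exact: (ctsS 0 _ (nbhs_entourage (S 0) entV)).
rewrite -filter_from_entourageE => -[A].
rewrite gs_entourageE => -[s [e [e0 sA]]] AS.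
exists s, e; split => // f fs.
have : S 0 - S (- f) = S f.
  have := linS (-1) f 0; rewrite S0 !addr0 !scaleN1r => ->.
  by rewrite sub0r opprK.
move=> <-; suff /xsectionP : xsection V (S 0) (S (- f)) by [].
apply: AS; apply/xsectionP; apply: sA.
by rewrite /seminorm_ball /= sub0r opprK.
Qed.

Lemma test_fun_gs (s : bool) (N : nat) : 2 < d -> (0 < N)%N ->
  (fun x => (test_fun s N x)%:C) \in gelfand_shilov_pred d.
Proof.
move=> d2 N0; apply/asboolP; split; first exact: smooth_test_fun.
move=> lam lam0; have [K [c [_ _ H]]] := gs_norm_test_fun d2 lam0.
exact: le_lt_trans (H s N N0) (ltry _).
Qed.

(** Continuity of the resolvent involves finitely many seminorms; their constants are merged by
    addition. *)
Lemma gs_seminorm_test_fun (l : seq {posnum R}) : 2 < d ->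
  exists K c : R, [/\ 0 < K, 0 <= c & forall s N (h : gelfand_shilov d), (0 < N)%N ->
    (h : R -> R[i]) = (fun x => (test_fun s N x)%:C) ->
    all (fun lam => gs_seminorm lam h <= K * expR (c * N%:R `^ d^-1)) l].
Proof.
move=> d2; elim: l => [|lam l [K [c [K0 c0 H]]]]; first by exists 1, 0.
have [K' [c' [K'0 c'0 H']]] := @gs_norm_test_fun R d lam%:num d2 [gt0 of lam%:num].
exists (K + K'), (c + c'); split; [exact: addr_gt0|exact: addr_ge0|].
move=> s N h N0 hE /=; apply/andP; split.
  rewrite -lee_fin gs_norm_fineK// hE (le_trans (H' s N N0))// lee_fin.
  rewrite ler_pM ?expR_ge0 ?(ltW K'0) ?lerDr ?(ltW K0)// ler_expR.
  by rewrite ler_wpM2r ?powR_ge0// lerDr.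
apply: sub_all (H s N h N0 hE) => m /le_trans; apply.
rewrite ler_pM ?expR_ge0 ?(ltW K0) ?lerDl ?(ltW K'0)// ler_expR.
by rewrite ler_wpM2r ?powR_ge0// lerDl.
Qed.

End GelfandShilovFacts.

(** * Points of large modulus lie in the spectrum *)

Section Spectrum.
Context {R : realType}.

(** Along the orbit of z under p, which tends to +oo, |u| does not decrease because |l| >= 1,
    whereas the decay of u forces it to 0. *)
Lemma functional_equation_vanish (u : R -> R[i]) (p : R -> R) (l : R[i]) (X M : R) :
  0 <= X -> (forall z, X <= z -> z + 2 <= p z) -> 1 <= normc l ->
  (forall x, (1 + `|x|) * normc (u x) <= M) ->
  (forall z, X <= z -> l * u z = u (p z)) -> forall z, X <= z -> u z = 0.
Proof.
move=> X0 pz l1 uM lu z Xz.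
have it k : z + k%:R <= iter k p z /\ normc (u z) <= normc (u (iter k p z)).
  elim: k => [|k [IH1 IH2]]; first by rewrite addr0.
  have Xk : X <= iter k p z by rewrite (le_trans _ IH1)// (le_trans Xz)// lerDl.
  split; first by rewrite (le_trans _ (pz _ Xk))// -natr1; lra.
  by rewrite (le_trans IH2)// -lu// normc_mul ler_peMl// normc_ge0.
suff nu : normc (u z) = 0.
  by apply/eqP; rewrite -normr_eq0 -normc_normr nu.
apply/eqP; rewrite eq_le normc_ge0 andbT.
rewrite leNgt; apply/negP => u0.
pose k := (Num.truncn (M / normc (u z))).+1.
have [h1 h2] := it k.
have : M < k%:R * normc (u z) by rewrite -ltr_pdivrMr// truncnS_gt.
apply/negP; rewrite -leNgt (le_trans _ (uM (iter k p z)))//.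
apply: ler_pM => //; first exact: normc_ge0.
have := ler_norm (iter k p z); lra.
Qed.

Lemma Re_le_normc (z : R[i]) : `|complex.Re z| <= normc z.
Proof. by case: z => a b /=; rewrite -sqrtr_sqr ler_wsqrtr// lerDl sqr_ge0. Qed.

Lemma normcR (a : R) : normc a%:C = `|a|.
Proof. by rewrite /= expr0n addr0 sqrtr_sqr. Qed.

Lemma gs_funZB (d : R) (l c : R[i]) (f g h : gelfand_shilov d) (y : R) :
  l *: f - g = c *: h -> l * f y - g y = c * h y.
Proof.
move=> H.
have : \val (l *: f - g) = \val (c *: h) by rewrite H.
by rewrite raddfB !linearZ => /(congr1 (fun k : R -> R[i] => k y)).
Qed.

(** p is psi conjugated by the sign (-1)^s, so that the argument always takes place near +oo. *)
Lemma large_not_in_resolvent_set (d : R) (psi p : {poly R}) (s : bool) (l : R[i]) :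
  2 < d -> (2 < size p)%N -> 0 < lead_coef p ->
  (forall x, (-1) ^+ s * psi.[(-1) ^+ s * x] = p.[x]) -> 1 <= normc l ->
  ~ resolvent_set (comp_op (d := d) (psi := psi)) l.
Proof.
move=> d2 sp lp psip l1 [S [g [_ gK Sg]] cS].
have d0 : 0 < d by lra.
have sgnK (x : R) : (-1) ^+ s * ((-1) ^+ s * x) = x.
  by rewrite mulrA -expr2 sqrr_sign mul1r.
have [t [e0 [e0_gt0 contS]]] := continuous_linear_gs 1%:pos cS.
have [K [c [K0 c0 HK]]] := gs_seminorm_test_fun t d2.
have [a [a0 [N0 nodes]]] := preimage_nodes sp lp.
have l2 : 0 < normc (l ^+ 2).
  by rewrite expr2 normc_mul mulr_gt0// (lt_le_trans _ l1).
have K'0 : 0 < 2 * normc (l ^+ 2) * K / e0 by rewrite divr_gt0// !mulr_gt0.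
have [n [N [n0 N0' N0N nN gap]]] := growth_gap N0 d2 a0 K'0 c0.
have [pz [x [px xS xp xL]]] := nodes N N0N N0'.
have NR : 0 < N%:R :> R by rewrite ltr0n.
have nR : 0 < n%:R :> R by rewrite ltr0n.
set E := expR (c * _) in gap.
have E0 : 0 < E by exact: expR_gt0.
(* This scaling bounds the seminorms in [t] of the argument of S by e0 / 2. The extra factor l^2
   there cancels the l^-2 met at the nodes. *)
pose del : R := e0 / (2 * normc (l ^+ 2) * K * E).
have del0 : 0 < del by rewrite divr_gt0// !mulr_gt0.
(* del^-1 is exactly the left side of [gap]. *)
have delV : del^-1 = 2 * normc (l ^+ 2) * K / e0 * E.
  by rewrite /del; field; rewrite !gt_eqF.
have delE : normc (l ^+ 2) * del * (K * E) = e0 / 2.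
  by rewrite /del; field; rewrite !gt_eqF.
clearbody del.
pose h0 := GelfandShilov (test_fun_gs s d2 N0').
pose u := S ((l ^+ 2 * del%:C) *: h0).
have u1 : gs_seminorm 1%:pos u < 1.
  apply: contS; apply: sub_all (HK s N h0 N0' erefl) => lam h0E.
  rewrite (le_lt_trans (gs_seminorm_scale _ _ _))// normc_mul normcR gtr0_norm//.
  apply: (@le_lt_trans _ _ (normc (l ^+ 2) * del * (K * E))).
    by rewrite ler_wpM2l// mulr_ge0 ?normc_ge0// ltW.
  by rewrite delE ltr_pdivrMr//; lra.
have eqn (y : R) : l * u y - u psi.[y] = l ^+ 2 * del%:C * (test_fun s N y)%:C.
  rewrite /u Sg; exact: (gs_funZB y (gK ((l ^+ 2 * del%:C) *: h0))).

(* The summand 0 matches the affine form in [derive1n_comp_affine]. *)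
pose w (y : R) := u ((-1) ^+ s * y + 0).
have test_sgn (y : R) : test_fun s N ((-1) ^+ s * y + 0) = test_fun false N y.
  by rewrite addr0 /test_fun sgnK expr0 mul1r.
have weqn (y : R) : l * w y - w p.[y] = l ^+ 2 * del%:C * (test_fun false N y)%:C.
  by rewrite -test_sgn -eqn /w -psip sgnK !addr0.
have l0 : l != 0.
  by apply/eqP => l0; move: l1; rewrite l0 ComplexField.Normc.normc0 ler10.
(* The decay of w is the term n = 0, q = 1 of the seminorm, and the right side of the equation
   vanishes beyond N + 1. *)
have w0 (z : R) : N%:R + 1 <= z -> w z = 0.
  apply: (@functional_equation_vanish w (horner p) l (N%:R + 1)
     (expR (- 1 * phi_omega_star d ((0 + 1)%N%:R / 1)))^-1) => //.
  - by move=> y Ny; apply: pz; rewrite (le_trans _ Ny)// lerDl.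
  - move=> y.
    have := le_trans (gs_term_le_seminorm 1%:pos u ((-1) ^+ s * y + 0) (0%N, 1%N)) (ltW u1).
    rewrite /gs_term /= expr1 -ler_pdivlMr ?expR_gt0// mul1r.
    rewrite {1}addr0 normrM normrX normrN1 expr1n mul1r.
    by rewrite /cderiv /= /w; case: (u _).
  - move=> y Ny; apply/eqP; rewrite -subr_eq0 weqn test_fun_eq0 ?mulr0//.
    rewrite expr0 mul1r ger0_norm; lra.
pose v (y : R) := complex.Re (w y).
have uS k y := (gs_fun_smooth u k y).1.
have [vE _] := derive1n_comp_affine ((-1) ^+ s) 0 n uS.
(* p (x j) lies in [N, N + 1 / 2], so its own image is at least N + 2, where w is 0, while x j <= N
   - 3 / 2 is off the bump. The equation at p (x j) and then at x j determines w (x j). *)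
have vx j : (j <= n)%N -> del * expR (-3) <= (-1) ^+ (j + false) * v (x j).
  move=> jn; have jN : (j.*2 <= N)%N by rewrite (leq_trans _ nN)// leq_double.
  have jN2 : j%:R / N%:R <= 2^-1 :> R.
    by rewrite ler_pdivrMr// mulrC ler_pdivlMr// -natrM ler_nat muln2.
  have jN0 : 0 <= j%:R / N%:R :> R by rewrite divr_ge0.
  have [q q3 qE] := packet_node N0' jN (erefl (N%:R + j%:R / N%:R : R)).
  have wy : w p.[x j] = l * (del * ((-1) ^+ j * q))%:C.
    have := weqn p.[x j]; rewrite [w p.[p.[x j]]]w0 ?subr0; last first.
      by rewrite (le_trans _ (pz _ _))// px; lra.
    rewrite [X in test_fun _ _ X]px qE expr2 => H.
    by apply: (mulfI l0); rewrite H [(del * _)%:C]rmorphM !mulrA.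
  have wx : w (x j) = (del * ((-1) ^+ j * q))%:C.
    have := weqn (x j); rewrite wy test_fun_eq0.
      by rewrite mulr0 => /eqP; rewrite subr_eq0 => /eqP H; apply: (mulfI l0).
    have := xp j; rewrite px expr0 mul1r ler_normr => ?.
    by apply/orP; right; lra.
  rewrite /v wx addn0 /= mulrCA signrMK.
  by rewrite ler_wpM2l// ltW.
have L0 : 0 < n%:R / (N%:R * Num.sqrt (a * N%:R)).
  by rewrite divr_gt0// mulr_gt0// sqrtr_gt0 mulr_gt0.
have [||z zP] := alternation_derive1n _ xS L0 (xL n) _ vx.
- move=> k y; exact: (derive1n_comp_affine ((-1) ^+ s) 0 k uS).2.
- by rewrite mulr_ge0 ?expR_ge0// ltW.
move: zP; rewrite (_ : v = fun y => (@complex.Re R \o u) ((-1) ^+ s * y + 0))// vE.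
rewrite normrM !normrX normrN1 !expr1n mul1r => zP.
have := le_lt_trans (gs_term_le_seminorm 1%:pos u ((-1) ^+ s * z + 0) (n, 0%N)) u1.
rewrite /gs_term /= expr0 mul1r addn0 => uz.
have := Re_le_normc (cderiv n u ((-1) ^+ s * z + 0)); rewrite /= => /(le_trans zP) {}zP.
have := expR_phi_omega_star_ge d0 n0.
set P := expR (- 1 * _) in uz *; set Q := _ ^- n in gap * => QP.
have Q0 : 0 <= Q by rewrite invr_ge0 exprn_ge0// powR_ge0.
(* The seminorm bound on the n-th derivative, multiplied by del^-1, is the opposite inequality. *)
move: gap; apply/negP; rewrite -leNgt.
set B := (2 / _) ^+ n in zP *.
have B0 : 0 <= B by rewrite exprn_ge0// divr_ge0// ltW.
have : del * (expR (-3) * B * Q) <= 1.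
  rewrite (le_trans _ (ltW uz))// 2!mulrA ler_pM// !mulr_ge0 ?expR_ge0// ltW//.
by rewrite mulrC -ler_pdivlMr// mul1r delV.
Qed.

(** The open discs of integer radius cover A; an integer larger than every index of a finite
    subfamily is a point of A outside all its discs. *)
Lemma not_compact_large (A : set (R[i])^o) :
  (forall z : R[i], 1 <= normc z -> A z) -> ~ compact A.
Proof.
move=> largeA; rewrite compact_cover => /(_ nat setT
  (fun n => [set z : (R[i])^o | normc z < n%:R])) [].
- move=> n _; rewrite openE => z /= zn; apply/nbhs_ballP.
  exists (n%:R - normc z)%:C; first by rewrite /= ltcR subr_gt0.
  move=> y; rewrite /ball /= normc_lt => yz.
  have -> : y = z + - (z - y) by rewrite opprB addrC subrK.
  by rewrite (le_lt_trans (normc_leD _ _))// normc_opp -ltrBrDl.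
- by move=> z _; exists (Num.truncn (normc z)).+1 => //=; exact: truncnS_gt.
move=> F _ FA; pose M := (\max_(i <- finmap.enum_fset F) i).+1.
have M0 : normc (M%:R : R)%:C = M%:R by rewrite normcR normr_nat.
have [|n nF] := FA (M%:R : R)%:C; first by apply: largeA; rewrite M0 ler1n.
change (normc (M%:R : R)%:C < n%:R -> False).
rewrite M0 ltr_nat ltnNge => /negP; apply.
by rewrite leqW// leq_bigmax_seq.
Qed.

(** The absence of fixed points enters here: if both leading coefficients were negative, then psi(x)
    < x for some x >= 0 and psi(-y) > -y for some y >= 0, so psi would cross the diagonal in
    between. *)
Lemma lead_coef_reflect_gt0 (psi : {poly R}) : (2 < size psi)%N ->
  (forall x, psi.[x] <> x) -> lead_coef psi < 0 ->
  0 < lead_coef (- (psi \Po (- 'X))).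
Proof.
move=> sp fix_psi lp; set q := - _.
have sq : size q = size psi by rewrite size_polyN size_comp_poly2// size_polyN size_polyX.
rewrite ltNge; apply/negP => lq.
have {}lq : lead_coef q < 0.
  by rewrite lt_neqAle lq andbT lead_coef_eq0 -size_poly_gt0 sq (ltn_trans _ sp).
have above (r : {poly R}) : size r = size psi -> lead_coef r < 0 ->
    exists2 x : R, 0 <= x & r.[x] < x.
  move=> sr lr.
  have l : lead_coef ('X - r) = - lead_coef r.
    by rewrite lead_coefDr ?lead_coefN// size_polyX size_polyN sr.
  have [|n Hn] := @poly_pinfty_gt_lc _ ('X - r); first by rewrite l oppr_gt0.
  exists (Num.max 0 n); first by rewrite le_max lexx.
  have /Hn : n <= Num.max 0 n by rewrite le_max lexx orbT.
  by rewrite l hornerD hornerN hornerX; lra.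
have [x x0 px] := above psi erefl lp.
have [y y0 qy] := above q sq lq.
have [||c [_ /rootP]] := @polyrcf.poly_ivt _ ('X - psi) (- y) x.
- by rewrite (le_trans _ x0)// oppr_le0.
- move: qy; rewrite /q !(hornerD, hornerN, hornerX, horner_comp).
  by move=> h; nra.
rewrite hornerD hornerN hornerX => /eqP; rewrite subr_eq0 => /eqP /esym.
exact: fix_psi.
Qed.

End Spectrum.

Theorem theorem4p2 (R : realType) (d : R) (psi : {poly R})
    (hdeg : (2 < size psi)%N)
    (hfix : forall x : R, psi.[x] <> x)
    (hd : 2 < d) :
  ~ compact (Waelbroeck_spectrum (K := R[i]) (E := gelfand_shilov d)
      (comp_op (d := d) (psi := psi))).
Proof.
apply: not_compact_large => l l1 [res _]; move: res.
have [lp|lp] := ltP 0 (lead_coef psi).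
  apply: (@large_not_in_resolvent_set R d psi psi false l) => // x.
  by rewrite expr0 !mul1r.
have {}lp : lead_coef psi < 0.
  by rewrite lt_neqAle lp andbT lead_coef_eq0 -size_poly_gt0 (ltn_trans _ hdeg).
(* When psi tends to -oo at +oo, its conjugate by x -> -x tends to +oo there. *)
apply: (@large_not_in_resolvent_set R d psi (- (psi \Po (- 'X))) true l) => //.
- by rewrite size_polyN size_comp_poly2// size_polyN size_polyX.
- exact: lead_coef_reflect_gt0.
- by move=> x; rewrite expr1 !mulN1r hornerN horner_comp hornerN hornerX.
Qed.
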